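(* Given a graph $G=(V,E)$, it can be decided in time $O(|V|+|E|)$ whether $G$ is a $2$-probe block graph.
   Context: Graphs are finite and simple. A block graph is a graph in which every block (maximal connected subgraph without a cut-vertex) is a clique. A graph $G=(V,E)$ is a $2$-probe block graph if there exist independent sets $N_1,N_2\subseteq V$ (possibly empty) and a block graph $G'=(V,E')$ with $E\subseteq E'$ such that every edge $xy\in E'\setminus E$ satisfies $x,y\in N_1$ or $x,y\in N_2$. *)

(* Defs.v *)
From mathcomp Require Import all_boot.

Set Implicit Arguments.
Unset Strict Implicit.
Unset Printing Implicit Defensive.

(** * Graphs *)

(* Finite simple graphs whose vertices are taken in an ambient finite type, so
   that a graph and its subgraphs live in the same type. *)
Record graph (T : finType) := Graph {
  verts : {set T};
  edges : {set {set T}};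
  graphP : [forall e in edges, (e \subset verts) && (#|e| == 2)]
}.

Section Graphs.
Variable T : finType.
Implicit Types (G H B : graph T) (x y : T) (N : {set T}).

(* [set x; x] is a singleton, so [adjacent G] is irreflexive. *)
Definition adjacent G : rel T := [rel x y | [set x; y] \in edges G].

Definition subgraph H G : Prop :=
  verts H \subset verts G /\ edges H \subset edges G.

Definition connected G : Prop :=
  verts G != set0 /\ {in verts G &, forall x y, connect (adjacent G) x y}.

Lemma del_vertex_subproof G x :
  [forall e in [set e in edges G | x \notin e],
     (e \subset verts G :\ x) && (#|e| == 2)].
Proof.
apply/forall_inP => e; rewrite inE => /andP[eG xe].
by have /andP[eV ->] := forall_inP (graphP G) e eG; rewrite subsetD1 eV xe.
Qed.

Definition del_vertex G x : graph T := Graph (del_vertex_subproof G x).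

Definition cut_vertex G x : Prop :=
  x \in verts G /\
  exists y z, [/\ y \in verts G :\ x, z \in verts G :\ x,
                  connect (adjacent G) y z &
                  ~~ connect (adjacent (del_vertex G x)) y z].

Definition nonseparable G : Prop := connected G /\ forall x, ~ cut_vertex G x.

Definition is_block G B : Prop :=
  [/\ subgraph B G, nonseparable B &
      forall H, subgraph H G -> nonseparable H -> subgraph B H -> subgraph H B].

Definition complete G : Prop :=
  {in verts G &, forall x y, x != y -> adjacent G x y}.

Definition block_graph G : Prop := forall B, is_block G B -> complete B.

Definition independent G N : Prop :=
  N \subset verts G /\ {in N &, forall x y, ~~ adjacent G x y}.

Definition two_probe_block_graph G : Prop :=
  exists (N1 N2 : {set T}) (G' : graph T),
    [/\ independent G N1, independent G N2, block_graph G',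
        verts G' = verts G /\ edges G \subset edges G' &
        forall x y, [set x; y] \in edges G' :\: edges G ->
          (x \in N1 /\ y \in N1) \/ (x \in N2 /\ y \in N2)].

End Graphs.

(** * Random access machine *)

(* Structured programs over a zero-initialised random access memory.  The
   memory is organised in arrays of natural numbers; a program mentions
   finitely many of them, and a scalar variable is cell 0 of an array. *)

Definition store := nat -> nat -> nat.

Definition update (s : store) (a i v : nat) : store :=
  fun b j => if (b == a) && (j == i) then v else s b j.

Inductive expr :=
  | ELit of nat
  | EGet of nat & expr
  | EAdd of expr & expr
  | ESub of expr & expr.

(* [CSet a i e] is the assignment a[i] := e; tests succeed on nonzero values. *)
Inductive cmd :=
  | CSkip
  | CSet of nat & expr & expr
  | CSeq of cmd & cmd
  | CIf of expr & cmd & cmd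
  | CWhile of expr & cmd.

Fixpoint eval (s : store) (e : expr) : nat :=
  match e with
  | ELit n => n
  | EGet a e => s a (eval s e)
  | EAdd e f => eval s e + eval s f
  | ESub e f => eval s e - eval s f
  end.

Fixpoint ecost (e : expr) : nat :=
  match e with
  | ELit _ => 1
  | EGet _ e => (ecost e).+1
  | EAdd e f | ESub e f => (ecost e + ecost f).+1
  end.

(* [exec W p s t s']: started in s, the program p halts in s' after t
   elementary steps, and it only ever stores values smaller than W.  An
   assignment of a value >= W is stuck, so a bound on W is a bound on the word
   size, and unit-cost arithmetic on huge numbers is excluded. *)
Inductive exec (W : nat) : cmd -> store -> nat -> store -> Prop :=
  | ExecSkip s : exec W CSkip s 1 s
  | ExecSet a i e s :
      eval s e < W ->
      exec W (CSet a i e) s (ecost i + ecost e).+1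
           (update s a (eval s i) (eval s e))
  | ExecSeq p q s t s' t' s'' :
      exec W p s t s' -> exec W q s' t' s'' ->
      exec W (CSeq p q) s (t + t') s''
  | ExecIfT e p q s t s' :
      eval s e != 0 -> exec W p s t s' ->
      exec W (CIf e p q) s (ecost e + t).+1 s'
  | ExecIfF e p q s t s' :
      eval s e = 0 -> exec W q s t s' ->
      exec W (CIf e p q) s (ecost e + t).+1 s'
  | ExecWhileT e p s t s' t' s'' :
      eval s e != 0 -> exec W p s t s' -> exec W (CWhile e p) s' t' s'' ->
      exec W (CWhile e p) s (ecost e + t + t').+1 s''
  | ExecWhileF e p s :
      eval s e = 0 -> exec W (CWhile e p) s (ecost e).+1 s.

Lemma exec_det W p s t1 s1 t2 s2 :
  exec W p s t1 s1 -> exec W p s t2 s2 -> t1 = t2 /\ s1 = s2.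
Proof.
move=> E; elim: E t2 s2 => {p s t1 s1} [||||||] *;
  match goal with F : exec _ _ _ ?t ?s |- _ = ?t /\ _ = ?s => inversion F end;
  subst=> //;
  repeat match goal with
  | IH : (forall t s, exec _ ?p ?s0 t s -> _), F : exec _ ?p ?s0 _ _ |- _ =>
      case: (IH _ _ F) => ? ?; clear IH; subst
  end => //;
  match goal with
  | F : is_true (eval _ _ != 0), F' : eval _ _ = 0 |- _ => by rewrite F' in F
  end.
Qed.

(** * Input format *)

(* The vertices are numbered 0, 1, ... in the order of vs, and ns v lists the
   neighbours of v; both orders are arbitrary. *)
Definition adjacency_lists (T : finType) (G : graph T)
    (vs : seq T) (ns : T -> seq T) : Prop :=
  perm_eq vs (enum (verts G)) /\
  {in verts G, forall v, perm_eq (ns v) (enum (adjacent G v))}.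

Definition encode (T : finType) (vs : seq T) (ns : T -> seq T) : seq (seq nat) :=
  [seq [seq index w vs | w <- ns v] | v <- vs].

(* Array 0 holds the number of vertices in cell 0, array 2 the concatenation of
   the adjacency lists, and array 1 the positions at which they start: the list
   of vertex i occupies the cells of array 2 from a1[i] to a1[i+1] - 1.  All
   other cells are 0. *)
Definition load (l : seq (seq nat)) : store := fun a i =>
  match a with
  | 0 => if i == 0 then size l else 0
  | 1 => nth 0 (0 :: scanl addn 0 (shape l)) i
  | 2 => nth 0 (flatten l) i
  | _ => 0
  end.

Definition accepting (s : store) : bool := s 0 0 != 0.

(* Main.v *)
(* Fix a vertex numbering.  A graph is a 2-probe block graph iff its vertices
   can be labelled by subsets of {1, 2} such that adjacent vertices have disjoint
   labels and nonadjacent vertices of one block have intersecting labels: filling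
   in the blocks then gives the block graph.

   The blocks need no depth-first search.  Run a breadth-first search and let the
   top of v be the parent of v, or the grandparent if v has a second neighbour on
   the previous level; in a 2-probe block graph this is the vertex of the block of
   v closest to the root, and the block minus its top is a connected component,
   of diameter at most 2, of the graph of the edges whose ends have equal tops.
   So the largest vertex within distance 2 identifies the block.  Each of these
   claims fails only if some vertex v has two adjacent nonneighbours and a
   neighbour u in its block while u also has a nonneighbour there, which forces
   the label {1, 2} on v and makes a nonempty label of u impossible.

   Within a block, the vertices with a nonneighbour must be labelled.  One that
   is adjacent to none of these, while two others of them are adjacent, needs the
   label {1, 2}; the others get one label, which is determined up to an exchange
   of 1 and 2 by adjacency to a reference vertex, and the exchanges are chosen
   from the root downwards.  The program computes these labels and accepts iff
   they are valid, which it verifies by comparing degrees with the number of block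
   members that do not share a label.  Hence acceptance is sound for whatever
   the earlier phases computed, and only completeness needs their analysis. *)

Require Import Defs.
From mathcomp Require Import all_boot zify.

Set Implicit Arguments.
Unset Strict Implicit.
Unset Printing Implicit Defensive.

(** * Structured programs on the random access machine *)

(** The machine model charges for every step and every large word, so the program is a fixed
    sequence of counting loops with loop-free bodies: time and word size are then bounded from the
    syntax alone. Even the breadth-first search has this form, one round doing one unit of its work.
    Each array beyond the loop counter is written by one loop only, so the effect of the loops is a
    system of equations on the final store, and the graph-theoretic arguments never see an
    intermediate store. Completeness uses one property of the block graph [G']: two neighbours of
    [x] that are connected in [G' - x] are adjacent. The detours around [x] run along the search
    tree. A wrong guess about blocks yields such a detour, which makes vertices of different levels
    adjacent in [G']. Levels mostly show that they are nonadjacent in [G], so they must share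
    labels, and too many labels are forced. *)

Inductive bexp :=
  | BEq of expr & expr
  | BLt of expr & expr
  | BNot of bexp
  | BAnd of bexp & bexp
  | BOr of bexp & bexp.

Fixpoint beval (s : store) (b : bexp) : bool :=
  match b with
  | BEq e f => eval s e == eval s f
  | BLt e f => eval s e < eval s f
  | BNot b => ~~ beval s b
  | BAnd b c => beval s b && beval s c
  | BOr b c => beval s b || beval s c
  end.

(** Subtraction is truncated: both differences vanish exactly for equal values, and [1 - x] is
    negation. Conjunction goes through De Morgan because there is no product. *)
Fixpoint test (b : bexp) : expr :=
  match b with
  | BEq e f => ESub (ELit 1) (EAdd (ESub e f) (ESub f e))
  | BLt e f => ESub f e
  | BNot b => ESub (ELit 1) (test b)
  | BAnd b c =>
      ESub (ELit 1) (EAdd (ESub (ELit 1) (test b)) (ESub (ELit 1) (test c)))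
  | BOr b c => EAdd (test b) (test c)
  end.

Lemma eval_test s b : (eval s (test b) != 0) = beval s b.
Proof.
by elim: b => [e f|e f|b IHb|b IHb c IHc|b IHb c IHc] /=; rewrite -?IHb -?IHc; lia.
Qed.

(** The loop-free commands: they always halt, so their semantics is a function and their cost has a
    syntactic bound. *)
Inductive stm :=
  | Skip
  | Assign of nat & expr & expr
  | Seq of stm & stm
  | If of bexp & stm & stm.

Fixpoint code (p : stm) : cmd :=
  match p with
  | Skip => CSkip
  | Assign a i e => CSet a i e
  | Seq p q => CSeq (code p) (code q)
  | If b p q => CIf (test b) (code p) (code q)
  end.

Fixpoint den (p : stm) (s : store) : store :=
  match p with
  | Skip => s
  | Assign a i e => update s a (eval s i) (eval s e)
  | Seq p q => den q (den p s)
  | If b p q => if beval s b then den p s else den q s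
  end.

Fixpoint scost (p : stm) : nat :=
  match p with
  | Skip => 1
  | Assign _ i e => (ecost i + ecost e).+1
  | Seq p q => scost p + scost q
  | If b p q => (ecost (test b) + scost p + scost q).+1
  end.

Fixpoint ereads (e : expr) : seq nat :=
  match e with
  | ELit _ => [::]
  | EGet a e => a :: ereads e
  | EAdd e f | ESub e f => ereads e ++ ereads f
  end.

Fixpoint breads (b : bexp) : seq nat :=
  match b with
  | BEq e f | BLt e f => ereads e ++ ereads f
  | BNot b => breads b
  | BAnd b c | BOr b c => breads b ++ breads c
  end.

Fixpoint reads (p : stm) : seq nat :=
  match p with
  | Skip => [::]
  | Assign _ i e => ereads i ++ ereads e
  | Seq p q => reads p ++ reads q
  | If b p q => breads b ++ reads p ++ reads q
  end.

Fixpoint writes (p : stm) : seq nat :=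
  match p with
  | Skip => [::]
  | Assign a _ _ => [:: a]
  | Seq p q | If _ p q => writes p ++ writes q
  end.

(* An upper bound on the difference between the value of an expression and the
   largest value in memory, when the shape of the expression provides one. *)
Fixpoint excess (e : expr) : option nat :=
  match e with
  | ELit n => Some n
  | EGet _ _ => Some 0
  | EAdd e (ELit k) => omap (addn k) (excess e)
  | EAdd _ _ => None
  | ESub e _ => excess e
  end.

Fixpoint tame (p : stm) : bool :=
  match p with
  | Skip => true
  | Assign _ _ e => excess e
  | Seq p q | If _ p q => tame p && tame q
  end.

Fixpoint growth (p : stm) : nat :=
  match p with
  | Skip => 0
  | Assign _ _ e => odflt 0 (excess e)
  | Seq p q | If _ p q => growth p + growth q
  end.

Definition bounded (B : nat) (s : store) := forall a i, s a i <= B.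

Lemma bounded_leq B C s : B <= C -> bounded B s -> bounded C s.
Proof. by move=> BC h a i; apply: leq_trans BC. Qed.

Lemma bounded_update B s a i v : bounded B s -> v <= B -> bounded B (update s a i v).
Proof. by move=> h vB b j; rewrite /update; case: ifP. Qed.

Lemma eval_excess B s e k : bounded B s -> excess e = Some k -> eval s e <= B + k.
Proof.
move=> h; elim: e k => [n|a e _|e IHe f _|e IHe f _] k //=.
- by move=> [<-]; rewrite leq_addl.
- by move=> [<-]; rewrite addn0.
- case: f => //= m; case: (excess e) IHe => //= j /(_ _ erefl) le [<-]; lia.
- by move=> /IHe; lia.
Qed.

Lemma den_bounded B p s : tame p -> bounded B s -> bounded (B + growth p) (den p s).
Proof.
elim: p B s => [|a i e|p IHp q IHq|b p IHp q IHq] B s /=.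
- by rewrite addn0.
- case E: (excess e) => [k|] //= _ h; apply: bounded_update.
    by apply: bounded_leq h; lia.
  exact: eval_excess h E.
- by move=> /andP[tp tq] h; rewrite addnA; apply: IHq => //; apply: IHp.
- move=> /andP[tp tq] h; case: ifP => _.
    by apply: bounded_leq (IHp _ _ tp h); lia.
  by apply: bounded_leq (IHq _ _ tq h); lia.
Qed.

Lemma exec_stm W B p s : tame p -> bounded B s -> B + growth p < W ->
  exists2 t, t <= scost p & exec W (code p) s t (den p s).
Proof.
elim: p B s => [|a i e|p IHp q IHq|b p IHp q IHq] B s /=.
- by move=> _ _ _; exists 1 => //; constructor.
- case E: (excess e) => [k|] //= _ h lt; exists (ecost i + ecost e).+1 => //.
  by constructor; apply: leq_ltn_trans lt; apply: eval_excess h E.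
- move=> /andP[tp tq] h lt.
  have [|t1 c1 e1] := IHp _ _ tp h; first lia.
  have [|t2 c2 e2] := IHq _ _ tq (den_bounded tp h); first lia.
  by exists (t1 + t2); [lia | apply: ExecSeq e1 e2].
- move=> /andP[tp tq] h lt; rewrite -eval_test; case: ifPn => [bT|bF].
    have [|t1 c1 e1] := IHp _ _ tp h; first lia.
    by exists (ecost (test b) + t1).+1; [lia | apply: ExecIfT].
  have [|t1 c1 e1] := IHq _ _ tq h; first lia.
  exists (ecost (test b) + t1).+1; first lia.
  by apply: ExecIfF => //; apply/eqP; move: bF; rewrite negbK.
Qed.

(** * Dependence on the arrays read and written *)

Definition agree (A : seq nat) (s s' : store) := {in A, forall a, s a =1 s' a}.

Lemma agree_sub A A' s s' : {subset A <= A'} -> agree A' s s' -> agree A s s'.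
Proof. by move=> sA h a /sA; apply: h. Qed.

Lemma eval_agree e s s' : agree (ereads e) s s' -> eval s e = eval s' e.
Proof.
elim: e => [n|a e IHe|e IHe f IHf|e IHe f IHf] //= h.
- rewrite IHe ?h ?mem_head //; apply: agree_sub h => x xe; exact: mem_behead.
- by rewrite IHe ?IHf //; apply: agree_sub h => x xe; rewrite mem_cat xe ?orbT.
- by rewrite IHe ?IHf //; apply: agree_sub h => x xe; rewrite mem_cat xe ?orbT.
Qed.

Lemma beval_agree b s s' : agree (breads b) s s' -> beval s b = beval s' b.
Proof.
elim: b => [e f|e f|b IHb|b IHb c IHc|b IHb c IHc] //= h; rewrite ?IHb ?IHc //;
  by rewrite ?(eval_agree (s' := s')) //; apply: agree_sub h => x xe;
     rewrite mem_cat xe ?orbT.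
Qed.

Lemma den_frame p s a : a \notin writes p -> den p s a =1 s a.
Proof.
elim: p s => [|b i e|p IHp q IHq|b p IHp q IHq] s //=.
- by rewrite inE => /negbTE ab j; rewrite /update ab.
- by rewrite mem_cat negb_or => /andP[ap aq] j; rewrite IHq ?IHp.
- by rewrite mem_cat negb_or => /andP[ap aq] j; case: ifP; rewrite ?IHq ?IHp.
Qed.

Lemma den_agree p s s' A : {subset reads p <= A} -> agree A s s' ->
  agree A (den p s) (den p s').
Proof.
elim: p s s' => [|b i e|p IHp q IHq|b p IHp q IHq] s s' //= rA h.
- have eqi : eval s i = eval s' i.
    by apply/eval_agree/(agree_sub _ h) => x xi; apply: rA; rewrite mem_cat xi.
  have eqe : eval s e = eval s' e.
    by apply/eval_agree/(agree_sub _ h) => x xi; apply: rA; rewrite mem_cat xi orbT.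
  by move=> a aA j; rewrite /update eqi eqe h.
- apply: IHq; last apply: IHp => //.
    by move=> x xi; apply: rA; rewrite mem_cat xi orbT.
  by move=> x xi; apply: rA; rewrite mem_cat xi.
- have -> : beval s b = beval s' b.
    by apply/beval_agree/(agree_sub _ h) => x xi; apply: rA; rewrite mem_cat xi.
  case: ifP => _; [apply: IHp|apply: IHq] => // x xi; apply: rA;
    by rewrite !mem_cat xi ?orbT.
Qed.

(* Array 3 holds the loop counter in its cell 0. *)
Definition counter : expr := EGet 3 (ELit 0).

(** The guard is nonzero exactly while the counter is below the bound. It is evaluated anew in every
    round, so the body must not write what the bound reads. *)
Definition for_code (l : expr * stm) : cmd :=
  CSeq (CSet 3 (ELit 0) (ELit 0))
    (CWhile (ESub l.1 counter)
       (CSeq (code l.2) (CSet 3 (ELit 0) (EAdd counter (ELit 1))))).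

Fixpoint for_den (p : stm) (k : nat) (s : store) : store :=
  if k is k'.+1 then update (den p (for_den p k' s)) 3 0 k else update s 3 0 0.

(** Per round, 6 steps increment the counter, 3 read and subtract it in the guard, and 1 is for the
    loop itself. The reset and the last test are paid by one additional round. *)
Definition for_cost (l : expr * stm) : nat := scost l.2 + ecost l.1 + 10.

Lemma for_den_counter p k s : for_den p k s 3 0 = k.
Proof. by case: k. Qed.

Lemma for_den_frame p k s a : a != 3 -> a \notin writes p -> for_den p k s a =1 s a.
Proof.
move=> /negbTE a3 ap; elim: k => [|k IHk] j /=; rewrite /update a3 //=.
by rewrite den_frame.
Qed.

Lemma for_den_counter_frame p k s j : 3 \notin writes p -> j != 0 ->
  for_den p k s 3 j = s 3 j.
Proof.
move=> wp /negbTE j0; elim: k => [|k IHk] /=; rewrite /update j0 //=.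
by rewrite den_frame.
Qed.

(** The successor of the growth accounts for the counter, which reaches [k] even if the body stores
    nothing large. *)
Lemma for_den_bounded B p k s : tame p -> bounded B s ->
  bounded (B + (growth p).+1 * k) (for_den p k s).
Proof.
move=> tp h; elim: k => [|k IHk] /=.
  by apply: bounded_update => //; apply: bounded_leq h; lia.
apply: bounded_update; last by rewrite mulSn; lia.
by apply: bounded_leq (den_bounded tp IHk); rewrite mulnS; lia.
Qed.

Lemma exec_for W B l s : tame l.2 -> bounded B s ->
    3 \notin writes l.2 -> all (fun a => a \notin 3 :: writes l.2) (ereads l.1) ->
    B + (growth l.2).+1 * eval s l.1 < W ->
  exists2 t, t <= for_cost l * (eval s l.1).+1 &
    exec W (for_code l) s t (for_den l.2 (eval s l.1) s).
Proof.
case: l => b p /= tp h wp rb; set L := eval s b => lt.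
have evb k : eval (for_den p k s) b = L.
  apply: eval_agree => a ab j; have := allP rb a ab.
  by rewrite inE negb_or => /andP[a3 ap]; rewrite for_den_frame.
suff loop d k : k + d = L -> exists2 t, t <= (scost p + ecost b + 10) * d + ecost b + 4 &
    exec W (CWhile (ESub b counter)
       (CSeq (code p) (CSet 3 (ELit 0) (EAdd counter (ELit 1)))))
      (for_den p k s) t (for_den p L s).
  have [t ct et] := loop L 0 erefl.
  exists (3 + t); first by rewrite /for_cost /=; rewrite mulnS; lia.
  by apply: ExecSeq et; apply: (@ExecSet W 3 (ELit 0) (ELit 0)) => /=; lia.
elim: d k => [|d IHd] k kd.
  have -> : k = L by lia.
  exists (ecost b + 3).+1; first lia.
  have -> : ecost b + 3 = ecost (ESub b counter) by rewrite /=; lia.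
  by apply: ExecWhileF; rewrite /= evb for_den_counter subnn.
have lk : B + (growth p).+1 * k + growth p < W.
  apply: leq_ltn_trans lt; rewrite -kd !mulSn; nia.
have [t2 c2 e2] := IHd k.+1 ltac:(lia).
have [t1 c1 e1] := exec_stm tp (for_den_bounded k tp h) lk.
exists ((ecost (ESub b counter)) + (t1 + 6) + t2).+1; first by rewrite /= mulnS; lia.
apply: ExecWhileT e2; first by rewrite /= evb for_den_counter; lia.
apply: ExecSeq e1 _.
have -> : for_den p k.+1 s =
  update (den p (for_den p k s)) 3 (eval (den p (for_den p k s)) (ELit 0))
    (eval (den p (for_den p k s)) (EAdd counter (ELit 1))).
  by rewrite /= den_frame // for_den_counter addn1.
by apply: ExecSet; rewrite /= den_frame // for_den_counter; nia.
Qed.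

(** * Sequences of loops *)

Definition prog_code (ls : seq (expr * stm)) (c : cmd) : cmd :=
  foldr (fun l => CSeq (for_code l)) c ls.

Definition prog_den (ls : seq (expr * stm)) (s : store) : store :=
  foldl (fun s l => for_den l.2 (eval s l.1) s) s ls.

Definition prog_writes (ls : seq (expr * stm)) : seq nat :=
  flatten [seq writes l.2 | l <- ls].

(** Loop bounds read only arrays that no loop writes, so all of them may be evaluated in the initial
    store. *)
Definition prog_wf (ls : seq (expr * stm)) : bool :=
  all (fun l => [&& tame l.2, 3 \notin writes l.2 &
         all (fun a => (a != 3) && (a \notin prog_writes ls)) (ereads l.1)]) ls.

Definition prog_growth (ls : seq (expr * stm)) : nat :=
  sumn [seq (growth l.2).+1 | l <- ls].

Definition prog_cost (ls : seq (expr * stm)) : nat := sumn [seq for_cost l | l <- ls].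

Lemma prog_den_frame ls s a : a != 3 -> a \notin prog_writes ls -> prog_den ls s a =1 s a.
Proof.
move=> a3; elim: ls s => [|l ls IHls] s //=.
by rewrite mem_cat negb_or => /andP[al als] j; rewrite IHls // for_den_frame.
Qed.

Lemma prog_den_counter_frame ls s j : 3 \notin prog_writes ls -> j != 0 ->
  prog_den ls s 3 j = s 3 j.
Proof.
move=> + j0; elim: ls s => [|l ls IHls] s //=.
by rewrite mem_cat negb_or => /andP[al als]; rewrite IHls // for_den_counter_frame.
Qed.

Lemma prog_wf_cat ls ls' : prog_wf (ls ++ ls') -> prog_wf ls'.
Proof.
rewrite /prog_wf all_cat => /andP[_]; apply: sub_all => l /and3P[-> -> /=].
apply: sub_all => a /andP[-> /=]; apply: contra.
by rewrite /prog_writes map_cat flatten_cat mem_cat => ->; rewrite orbT.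
Qed.

Lemma prog_wf_nth ls k : k < size ls -> prog_wf ls ->
  [/\ tame (nth (ELit 0, Skip) ls k).2, 3 \notin writes (nth (ELit 0, Skip) ls k).2 &
    {in ereads (nth (ELit 0, Skip) ls k).1, forall a, a != 3 /\ a \notin prog_writes ls}].
Proof.
move=> kl wf; have /and3P[tl wl /allP rl] := all_nthP (ELit 0, Skip) wf k kl.
by split=> // a ab; apply/andP; exact: rl.
Qed.

Lemma prog_wf_counter ls : prog_wf ls -> 3 \notin prog_writes ls.
Proof.
rewrite /prog_wf; move: {1}(prog_writes ls) => A; elim: ls => [|l ls IHls] //=.
by move=> /andP[/and3P[_ wl _] /IHls]; rewrite /prog_writes /= mem_cat negb_or wl.
Qed.

Lemma exec_prog W B L ls p s : prog_wf ls -> tame p -> bounded B s ->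
    all (fun l => eval s l.1 <= L) ls -> B + prog_growth ls * L + growth p < W ->
  exists2 t, t <= prog_cost ls * L.+1 + scost p &
    exec W (prog_code ls (code p)) s t (den p (prog_den ls s)).
Proof.
elim: ls s B => [|l ls IHls] s B wf tp h lL lt.
  have [|t ct et] := exec_stm (W := W) tp h; last by exists t.
  by apply: leq_ltn_trans lt; rewrite mul0n addn0.
have /andP[/and3P[tl wl rl] _] := wf; have /andP[lL0 lLs] := lL.
have [||t1 c1 e1] := exec_for (W := W) tl h wl.
- apply: sub_all rl => a /= /andP[a3]; rewrite inE negb_or a3 /=; apply: contra => al.
  by rewrite mem_cat al.
- by apply: leq_ltn_trans lt; rewrite /prog_growth /= -/(prog_growth ls); nia.
have wfl : prog_wf ls by apply: (@prog_wf_cat [:: l]).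
have bls : all (fun l' => eval (for_den l.2 (eval s l.1) s) l'.1 <= L) ls.
  apply/(all_nthP (ELit 0, Skip)) => k kl;
    rewrite (_ : eval _ _ = eval s (nth (ELit 0, Skip) ls k).1).
    exact: (all_nthP (ELit 0, Skip) lLs).
  have [_ _ rk] := prog_wf_nth (ls := l :: ls) (k := k.+1) kl wf.
  apply: eval_agree => a /rk[a3]; rewrite /prog_writes /= mem_cat negb_or => /andP[aw _] j.
  by rewrite for_den_frame.
have [|t2 c2 e2] := IHls _ _ wfl tp (for_den_bounded (eval s l.1) tl h) bls.
  by apply: leq_ltn_trans lt; rewrite /prog_growth /= -/(prog_growth ls); nia.
exists (t1 + t2); last exact: ExecSeq e1 e2.
by rewrite /prog_cost /= -/(prog_cost ls); nia.
Qed.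

Definition replace (s : store) (a : nat) (x : nat -> nat) : store :=
  fun b j => if b == a then x j else s b j.

(* When a program writes each array in one loop only, the contents of an array
   during its loop are determined by the final contents of the other arrays. *)
Lemma loop_final ls k X s :
    let l := nth (ELit 0, Skip) ls k in let s' := prog_den ls s in
    k < size ls -> prog_wf ls -> X != 3 ->
    X \notin prog_writes (take k ls) -> X \notin prog_writes (drop k.+1 ls) ->
    all (pred1 X) (writes l.2) ->
    all (fun a => (a == X) || (a == 3) || (a \notin prog_writes (drop k.+1 ls))) (reads
      l.2) ->
    (forall j, s X j = 0) ->
  exists x : nat -> nat -> nat,
    [/\ forall j, x 0 j = 0,
        forall i, i < eval s l.1 ->
          x i.+1 =1 den l.2 (replace (update s' 3 0 i) X (x i)) X &
        x (eval s l.1) =1 s' X].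
Proof.
move=> l s' kl wf X3 Xt Xd wl rl s0.
have els : ls = take k ls ++ l :: drop k.+1 ls by rewrite -drop_nth // cat_take_drop.
set s1 := prog_den (take k ls) s.
have es' : s' = prog_den (drop k.+1 ls) (for_den l.2 (eval s1 l.1) s1).
  by rewrite /s' {1}els /prog_den foldl_cat.
have [tl w3 bl] := prog_wf_nth kl wf.
have sub_t : {subset prog_writes (take k ls) <= prog_writes ls}.
  by move=> a at_; rewrite {1}els /prog_writes map_cat flatten_cat mem_cat at_.
have sub_d : {subset prog_writes (drop k.+1 ls) <= prog_writes ls}.
  by move=> a at_; rewrite {1}els /prog_writes map_cat flatten_cat mem_cat /= mem_cat
    at_ !orbT.
have w3' := prog_wf_counter wf.
have eL : eval s1 l.1 = eval s l.1.
  apply: eval_agree => a /bl[a3 al] j; rewrite /s1 prog_den_frame //.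
  by apply: contra al => /sub_t.
rewrite eL in es'.
exists (fun i => for_den l.2 i s1 X); split=> [j|i iL j|j].
- by rewrite /= /update (negbTE X3) /= /s1 prog_den_frame.
- rewrite /= {1}/update (negbTE X3) /=.
  (* The body reads [X], the counter and arrays that neither it nor a later loop writes, so it
     cannot tell the current store from the final one with [X] and the counter replaced. *)
  apply: (@den_agree _ _ _ (X :: reads l.2)); last exact: mem_head.
    by move=> a; rewrite inE orbC => ->.
  move=> a; rewrite inE => aX j'; rewrite /replace; case: eqP => [->//|/eqP aX'].
  have {}aX : a \in reads l.2 by move: aX; rewrite (negbTE aX').
  rewrite /update; case: eqP => [->|/eqP a3] /=.
    case: eqP => [->|/eqP j0]; first by rewrite for_den_counter.
    rewrite for_den_counter_frame // es' prog_den_counter_frame //.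
      by rewrite for_den_counter_frame.
    by apply: contra w3' => /sub_d.
  have := allP rl a aX; rewrite (negbTE aX') (negbTE a3) /= => ad.
  rewrite es' prog_den_frame // !for_den_frame //;
    by apply/negP => /(allP wl) /=; rewrite (negbTE aX').
- by rewrite es' prog_den_frame.
Qed.

(** * The program *)

Section Program.

Local Notation lit := ELit.
Local Notation "a $[ e ]" := (EGet a e) (at level 2, format "a $[ e ]").
Local Notation var a := (EGet a (ELit 0)).
Local Notation "e :+ f" := (EAdd e f) (at level 50, left associativity).
Local Notation "e :- f" := (ESub e f) (at level 50, left associativity).

(* Arrays.  4, 5: head and tail of the queue 8; 6: next slot to scan; 7: next
   root to try; 13: owner of a slot.
   Of a vertex: 9 visited; 10 level; 11 parent (n for a root); 12 root; 14 has a
   neighbour on the previous level besides its parent; 15 top (n if there is none);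
   17, 19 largest vertex within distance 1, 2 in the graph of edges with equal tops
   (computed from 16, 18); 29 needs a label; 32 needs the label {1, 2}; 35 colour.
   A class consists of the vertices v with 19[v] = k and of their top.  Its members
   are numbered so that v < n stands for v in its own class, and n + k (kept in 23)
   for the top of class k; n + k is alone in class n + k if k has no top.
   Of a member: 21 class; 22 vertex; 27 degree within the class; 30 sees a member
   which, like itself, has a nonneighbour in the class; 34 adjacent to the reference
   member.  Of a slot: 24, 25 the members at its ends.
   Of a class: 28 size; 31 contains an edge between members with nonneighbours;
   33 reference member plus 1; 37, 38, 39 number of members with 1, with 2, with a
   label.  20, 26, 36, 40: failed checks. *)
Definition vertex_count : expr := var 0.
Definition slot_count : expr := 1$[vertex_count].
Definition head_vertex : expr := 8$[var 4].
Definition neighbour : expr := 2$[var 6].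

Definition bfs_push_code : stm :=
  Seq (Assign 9 neighbour (lit 1))
  (Seq (Assign 10 neighbour (10$[head_vertex] :+ lit 1))
  (Seq (Assign 11 neighbour head_vertex)
  (Seq (Assign 12 neighbour 12$[head_vertex])
  (Seq (Assign 8 (var 5) neighbour)
       (Assign 5 (lit 0) (var 5 :+ lit 1)))))).

Definition bfs_scan_code : stm :=
  Seq (Assign 13 (var 6) head_vertex) (Assign 6 (lit 0) (var 6 :+ lit 1)).

Definition bfs_next_code : stm :=
  Seq (Assign 4 (lit 0) (var 4 :+ lit 1)) (Assign 6 (lit 0) 1$[head_vertex]).

(** A new root takes the level of the last queued vertex. For the first root the truncated index
    reads cell 0, and the level is 0. *)
Definition bfs_root_code : stm :=
  Seq (Assign 9 (var 7) (lit 1))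
  (Seq (Assign 10 (var 7) 10$[8$[var 5 :- lit 1]])
  (Seq (Assign 11 (var 7) vertex_count)
  (Seq (Assign 12 (var 7) (var 7))
  (Seq (Assign 8 (var 5) (var 7))
  (Seq (Assign 5 (lit 0) (var 5 :+ lit 1))
       (Assign 6 (lit 0) 1$[var 7])))))).

Definition bfs_code : stm :=
  If (BLt (var 4) (var 5))
    (If (BLt (var 6) 1$[head_vertex :+ lit 1])
       (Seq (If (BEq 9$[neighbour] (lit 0)) bfs_push_code Skip) bfs_scan_code)
       bfs_next_code)
    (If (BLt (var 7) vertex_count)
       (Seq (If (BEq 9$[var 7] (lit 0)) bfs_root_code Skip)
          (Assign 7 (lit 0) (var 7 :+ lit 1)))
       Skip).

Local Notation n := vertex_count.
Local Notation m := slot_count.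
Local Notation n2 := (n :+ n).
Local Notation i := counter.
Local Notation dst := (2$[i]).
Local Notation src := (13$[i]).
Local Notation mark a j := (Assign a j (ELit 1)).

Definition when b p := If b p Skip.
Definition neq e f := BNot (BEq e f).
Definition nonuniv_test e := neq (27$[e] :+ lit 1) 28$[21$[e]].
Definition single_test e := BAnd (neq 29$[e] (lit 0)) (BEq 32$[e] (lit 0)).
Definition lab1_test e :=
  BOr (neq 32$[e] (lit 0)) (BAnd (neq 29$[e] (lit 0)) (BEq 35$[e] (lit 0))).
Definition lab2_test e :=
  BOr (neq 32$[e] (lit 0)) (BAnd (neq 29$[e] (lit 0)) (neq 35$[e] (lit 0))).
Definition share_test e f :=
  BOr (BAnd (lab1_test e) (lab1_test f)) (BAnd (lab2_test e) (lab2_test f)).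
Definition count_check e := If (BEq (27$[i] :+ e) 28$[21$[i]]) Skip (mark 40 (lit 0)).
Definition incr a j := Assign a j (a$[j] :+ lit 1).

(** Arrays 16 and 18 hold maxima plus one, so that the initial 0 means that there is none. The
    colouring loop follows the queue 8, to treat the top of a vertex before the vertex; for the
    absent top [n] it reads a colour that is always 0. *)
Definition loops : seq (expr * stm) := [::
  (m :+ n2, bfs_code);
  (m, when (BAnd (BEq 10$[dst] (10$[src] :+ lit 1)) (neq 11$[dst] src))
     (mark 14 dst));
  (n, If (neq 14$[i] (lit 0)) (Assign 15 i 11$[11$[i]]) (Assign 15 i 11$[i]));
  (m, when (BAnd (BEq 15$[src] 15$[dst]) (BLt 16$[src] (dst :+ lit 1)))
     (Assign 16 src (dst :+ lit 1)));
  (n, If (BLt 16$[i] (i :+ lit 1)) (Assign 17 i i) (Assign 17 i (16$[i] :- lit 1)));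
  (m, when (BAnd (BEq 15$[src] 15$[dst]) (BLt 18$[src] (17$[dst] :+ lit 1)))
     (Assign 18 src (17$[dst] :+ lit 1)));
  (n, If (BLt 18$[i] (17$[i] :+ lit 1)) (Assign 19 i 17$[i]) (Assign 19 i (18$[i] :-
    lit 1)));
  (n, when (neq 15$[19$[i]] 15$[i]) (mark 20 (lit 0)));
  (n2, If (BLt i n) (Assign 21 i 19$[i])
     (If (BLt 15$[i :- n] n) (Assign 21 i (i :- n)) (Assign 21 i i)));
  (n2, If (BLt i n) (Assign 22 i i) (Assign 22 i 15$[i :- n]));
  (n2, If (BLt i n) Skip (Assign 23 (i :- n) i));
  (m, If (BAnd (neq 19$[src] 19$[dst]) (BEq src 15$[dst]))
     (Assign 24 i 23$[19$[dst]]) (Assign 24 i src));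
  (m, If (BAnd (neq 19$[src] 19$[dst]) (BEq dst 15$[src]))
     (Assign 25 i 23$[19$[src]]) (Assign 25 i dst));
  (m, when (neq 21$[24$[i]] 21$[25$[i]]) (mark 26 (lit 0)));
  (m, incr 27 24$[i]);
  (n2, incr 28 21$[i]);
  (n2, when (nonuniv_test i) (mark 29 22$[i]));
  (m, when (BAnd (nonuniv_test 24$[i]) (nonuniv_test 25$[i]))
     (mark 30 24$[i]));
  (m, when (BAnd (nonuniv_test 24$[i]) (nonuniv_test 25$[i]))
     (mark 31 21$[24$[i]]));
  (n2, when (BAnd (nonuniv_test i) (BAnd (BEq 30$[i] (lit 0)) (neq 31$[21$[i]] (lit 0))))
     (mark 32 22$[i]));
  (n2, when (single_test 22$[i]) (Assign 33 21$[i] (i :+ lit 1)));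
  (m, when (BEq 33$[21$[24$[i]]] (24$[i] :+ lit 1)) (mark 34 25$[i]));
  (n, If (BEq 34$[8$[i]] 35$[15$[8$[i]]]) (Assign 35 8$[i] (lit 0)) (Assign 35 8$[i]
    (lit 1)));
  (m, when (share_test src dst) (mark 36 (lit 0)));
  (n2, when (lab1_test 22$[i]) (incr 37 21$[i]));
  (n2, when (lab2_test 22$[i]) (incr 38 21$[i]));
  (n2, when (BOr (lab1_test 22$[i]) (lab2_test 22$[i])) (incr 39 21$[i]));
  (n2, If (lab1_test 22$[i])
     (If (lab2_test 22$[i]) (count_check 39$[21$[i]]) (count_check 37$[21$[i]]))
     (If (lab2_test 22$[i]) (count_check 38$[21$[i]]) (count_check (lit 1))))].

Definition verdict : stm :=
  Assign 0 (lit 0) (lit 1 :- (var 20 :+ var 26 :+ var 36 :+ var 40)).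

End Program.

Lemma loops_wf : prog_wf loops. Proof. by vm_compute. Qed.

(** * Contents of an array after a loop, from the recurrence of its rounds *)

Section Sequences.
Variables (L : nat) (x : nat -> nat -> nat).
Hypothesis x0 : forall j, x 0 j = 0.

Lemma seq_map (f : nat -> nat) :
  (forall k, k < L -> forall j, x k.+1 j = if j == k then f k else x k j) ->
  forall j, j < L -> x L j = f j.
Proof.
move=> xS; suff h k : k <= L -> forall j, j < k -> x k j = f j by apply: h.
elim: k => // k IHk kL j; rewrite ltnS leq_eqVlt xS //; case: eqP => [->//|_] /= jk.
exact: IHk (ltnW kL) j jk.
Qed.

Lemma seq_mark (c : pred nat) (f : nat -> nat) :
  (forall k, k < L -> forall j, x k.+1 j = if c k && (j == f k) then 1 else x k j) ->
  forall j, x L j <= 1 /\ (x L j != 0 <-> exists k, [/\ k < L, c k & f k = j]).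
Proof.
move=> xS; suff h k : k <= L ->
    forall j, x k j <= 1 /\ (x k j != 0 <-> exists k', [/\ k' < k, c k' & f k' = j])
      by apply: h.
elim: k => [|k IHk] kL j; first by rewrite x0; split=> //; split=> // -[k []].
have [le1 [h1 h2]] := IHk (ltnW kL) j; rewrite xS //.
case: ifP => [/andP[ck /eqP jf]|ckf].
  by split=> //; split=> // _; exists k.
split=> //; split=> [/h1[k' [kk ck fk]]|[k' [kk ck fk]]].
  by exists k'; split=> //; apply: ltnW.
apply: h2; exists k'; split=> //; move: kk; rewrite ltnS leq_eqVlt => /predU1P[kE|//].
by rewrite -kE ck fk eqxx in ckf.
Qed.

Lemma seq_count (c : pred nat) (f : nat -> nat) :
  (forall k, k < L -> forall j, x k.+1 j = if c k &&
    (j == f k) then x k j + 1 else x k j) ->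
  forall j, x L j = count (fun k => c k && (f k == j)) (iota 0 L).
Proof.
move=> xS; suff h k : k <= L ->
  forall j, x k j = count (fun k => c k && (f k == j)) (iota 0 k) by apply: h.
elim: k => [|k IHk] kL j; first by rewrite x0.
rewrite -addn1 iotaD count_cat /= addn1 xS // IHk ?(ltnW kL) // addn0 (eq_sym j).
by case: ifP => // _; rewrite addn0.
Qed.

Lemma seq_max (c : pred nat) (f v : nat -> nat) :
  (forall k, k < L -> forall j,
    x k.+1 j = if c k && (x k (f k) < v k + 1) && (j == f k) then v k + 1 else x k j) ->
  forall j, (forall k, k < L -> c k -> f k = j -> v k < x L j) /\
    (x L j = 0 \/ exists k, [/\ k < L, c k, f k = j & x L j = (v k).+1]).
Proof.
move=> xS; suff h k : k <= L -> forall j,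
    (forall k', k' < k -> c k' -> f k' = j -> v k' < x k j) /\
    (x k j = 0 \/ exists k', [/\ k' < k, c k', f k' = j & x k j = (v k').+1]) by apply: h.
elim: k => [|k IHk] kL j; first by rewrite x0; split=> //; left.
have [h1 h2] := IHk (ltnW kL) j; rewrite xS //;
  case: ifP => [/andP[/andP[ck lt] /eqP jf]|no].
  rewrite -jf in lt; split; last by right; exists k; rewrite addn1.
  move=> k'; rewrite ltnS leq_eqVlt => /predU1P[->|kk] ck' fk'; first by rewrite addn1.
  by apply: ltn_trans (h1 k' kk ck' fk') lt.
split; last by case: h2 => [|[k' [kk ck' fk' xk]]]; [left|right; exists k'; split=> //;
  apply: ltnW].
move=> k'; rewrite ltnS leq_eqVlt => /predU1P[->|kk] ck' fk'; last exact: h1.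
by move: no; rewrite ck' fk' eqxx andbT /=; lia.
Qed.

Lemma seq_last (c : pred nat) (f : nat -> nat) :
  (forall k, k < L -> forall j, x k.+1 j = if c k && (j == f k) then k + 1 else x k j) ->
  forall j, (x L j = 0 /\ forall k, k < L -> f k = j -> ~~ c k) \/
    exists k0, [/\ k0 < L, x L j = k0.+1, f k0 = j, c k0 &
      forall k, k < L -> f k = j -> c k -> k <= k0].
Proof.
move=> xS; suff h k : k <= L -> forall j,
    (x k j = 0 /\ forall k', k' < k -> f k' = j -> ~~ c k') \/
    exists k0, [/\ k0 < k, x k j = k0.+1, f k0 = j, c k0 &
      forall k', k' < k -> f k' = j -> c k' -> k' <= k0] by apply: h.
elim: k => [|k IHk] kL j; first by left; rewrite x0.
rewrite xS //; case: ifP => [/andP[ck /eqP jf]|no].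
  by right; exists k; rewrite addn1.
have nk : f k = j -> ~~ c k by move=> fk; move: no; rewrite fk eqxx andbT => ->.
case: (IHk (ltnW kL) j) => [[xk h]|[k0 [lt xk fk ck h]]].
  by left; split=> // k'; rewrite ltnS leq_eqVlt => /predU1P[->//|]; apply: h.
right; exists k0; split=> //; first exact: ltnW.
move=> k'; rewrite ltnS leq_eqVlt => /predU1P[->|kk]; last exact: h.
by move=> /nk /negbTE ->.
Qed.

Lemma seq_flag (c : pred nat) :
  (forall k, k < L -> forall j, x k.+1 j = if c k && (j == 0) then 1 else x k j) ->
  x L 0 = 0 <-> forall k, k < L -> ~~ c k.
Proof.
move=> /(seq_mark (f := fun=> 0))/(_ 0)[_ [h1 h2]]; split=> [xL k kL|h].
  by apply/negP => ck; suff : x L 0 != 0; [rewrite xL | apply: h2; exists k].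
by apply/eqP/negPn/negP => /h1[k [kL ck _]]; have := h k kL; rewrite ck.
Qed.

Lemma seq_inj (c : pred nat) (f v : nat -> nat) :
    (forall k, k < L -> forall j, x k.+1 j = if c k && (j == f k) then v k else x k j) ->
    (forall k k', k < L -> k' < L -> c k -> c k' -> f k = f k' -> k = k') ->
  forall k, k < L -> c k -> x L (f k) = v k.
Proof.
move=> xS fI; suff h l : l <= L -> forall k, k < l -> c k -> x l (f k) = v k by apply: h.
elim: l => // l IHl lL k kl ck; rewrite xS //; case: ifP => [/andP[cl /eqP fkl]|no].
  by rewrite -(fI k l _ _ ck cl fkl) //; apply: leq_trans lL.
move: kl; rewrite ltnS leq_eqVlt => /predU1P[kE|kl]; last exact: IHl (ltnW lL) k kl ck.
by move: no; rewrite -kE ck eqxx.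
Qed.

End Sequences.


(** * Breadth-first search *)

(** Applied to a queue without repetitions: its vertices own at most all slots. *)
Lemma sum_inj_leq (f q : nat -> nat) t n :
    (forall i, i < t -> q i < n) ->
    (forall i i', i < t -> i' < t -> q i = q i' -> i = i') ->
  \sum_(i < t) f (q i) <= \sum_(i < n) f i.
Proof.
move=> qn qi; rewrite -(big_mkord xpredT (fun i => f (q i))) -(big_mkord xpredT f).
rewrite /index_iota !subn0 -(big_map q xpredT f).
apply: uniq_sub_le_big => //; last 2 first.
- exact: iota_uniq.
- by move=> _ /mapP[i it ->]; move: it; rewrite !mem_iota => /qn.
- by move=> x y; apply: leq_addr.
rewrite map_inj_in_uniq ?iota_uniq // => i i'; rewrite !mem_iota.
exact: qi.
Qed.

Lemma inj_leq (q : nat -> nat) t n :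
    (forall i, i < t -> q i < n) ->
    (forall i i', i < t -> i' < t -> q i = q i' -> i = i') -> t <= n.
Proof.
move=> qn qi; have := sum_inj_leq (fun=> 1) qn qi.
by rewrite !sum_nat_const !card_ord !muln1.
Qed.

(** The input on the level of numbers: [st] holds the starts of the lists and [dst] their
    entries. *)
Record lists (n : nat) (st dst : nat -> nat) (e : rel nat) : Prop := Lists {
  l_start0 : st 0 = 0;
  l_start_leq : forall u, u < n -> st u <= st u.+1;
  l_slot : forall u j, u < n -> st u <= j < st u.+1 -> e u (dst j);
  l_edge : forall u w, e u w -> exists2 j, st u <= j < st u.+1 & dst j = w;
  l_lt : forall u w, e u w -> u < n /\ w < n;
  l_inj : forall u j j', u < n -> st u <= j < st u.+1 -> st u <= j' < st u.+1 ->
    dst j = dst j' -> j = j';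
  l_sym : symmetric e;
  l_irr : irreflexive e }.

Definition upd (f : nat -> nat) i v := fun j => if j == i then v else f j.

Lemma upd_same f i v : upd f i v i = v. Proof. by rewrite /upd eqxx. Qed.
Lemma upd_other f i v j : j != i -> upd f i v j = f j.
Proof. by move=> /negbTE ij; rewrite /upd ij. Qed.

Section Bfs.
Variables (n : nat) (st dst : nat -> nat) (e : rel nat).
Hypothesis L : lists n st dst e.

Lemma start_mono u v : u <= v -> v <= n -> st u <= st v.
Proof.
elim: v => [|v IHv]; first by rewrite leqn0 => /eqP->.
rewrite leq_eqVlt => /predU1P[->//|uv] vn.
by apply: leq_trans (IHv uv (ltnW vn)) (l_start_leq L vn).
Qed.

Lemma slot_owner u v j : u < n -> v < n -> st u <= j < st u.+1 ->
  st v <= j < st v.+1 -> u = v.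
Proof.
move=> un vn /andP[uj ju] /andP[vj jv].
have [uv|vu|//] := ltngtP u v.
  by have := start_mono uv (ltnW vn); lia.
by have := start_mono vu (ltnW un); lia.
Qed.

Lemma slot_exists j : j < st n -> exists2 u, u < n & st u <= j < st u.+1.
Proof.
suff: forall k, k <= n -> j < st k -> exists2 u, u < n & st u <= j < st u.+1 by apply.
elim=> [|k IHk] kn jk; first by rewrite (l_start0 L) in jk.
have [jk'|jk'] := ltnP j (st k); first exact: IHk (ltnW kn) jk'.
by exists k; rewrite ?jk'.
Qed.

Definition deg u := st u.+1 - st u.

Lemma sum_deg : \sum_(i < n) deg i = st n.
Proof.
suff h k : k <= n -> \sum_(i < k) deg i = st k by apply: h.
elim: k => [|k IHk] kn; first by rewrite big_ord0 (l_start0 L).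
by rewrite big_ord_recr /= IHk ?(ltnW kn) // subnKC // (l_start_leq L).
Qed.

(* Levels do not decrease along the queue, even where a new component starts, so
   a root need not have level 0.  By [i_pot] every step before the end either moves
   the head, tries the next root, or scans one slot, so n + n + M steps suffice. *)
Record bfs_inv (q : nat ->
  nat) head tail j r vis lev par root src (k : nat) : Prop := BfsInv {
  i_head : head <= tail;
  i_r : r <= n;
  i_q : forall i, i < tail -> q i < n;
  i_inj : forall i i', i < tail -> i' < tail -> q i = q i' -> i = i';
  i_vis : forall v, v < n -> vis v != 0 <-> exists2 i, i < tail & q i = v;
  i_roots : forall v, v < r -> vis v != 0;
  i_cur : head < tail -> st (q head) <= j <= st (q head).+1;
  i_mono : forall i i', i <= i' -> i' < tail -> lev (q i) <= lev (q i');
  i_near : forall i, i < tail -> head < tail -> lev (q i) <= (lev (q head)).+1;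
  i_pend : forall i, head <= i -> i < tail -> root (q i) = root (q head);
  i_par : forall i, i < tail -> (par (q i) = n /\ root (q i) = q i) \/
    exists i', [/\ i' < i, par (q i) = q i', e (q i') (q i) & lev (q i) = (lev (q i')).+1];
  i_done : forall i j', i < tail -> st (q i) <= j' < st (q i).+1 ->
    (i < head) || (i == head) && (j' < j) ->
    [/\ src j' = q i, vis (dst j') != 0, lev (dst j') <= (lev (q i)).+1 &
        root (dst j') = root (q i)];
  i_pot : head = tail /\ r = n \/
    r + head + \sum_(i < head) deg (q i) + (if head < tail then j - st (q head) else 0)
      = k }.

(** The count [k] stays, since a push is completed by scanning its slot in the same round;
    [bfs_root] and [bfs_root_next] are paired in the same way. *)
Lemma bfs_push q head tail j r vis lev par root src k w :
    bfs_inv q head tail j r vis lev par root src k -> head < tail ->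
    e (q head) w -> vis w = 0 ->
  bfs_inv (upd q tail w) head (tail + 1) j r (upd vis w 1) (upd lev w (lev (q head) + 1))
    (upd par w (q head)) (upd root w (root (q head))) src k.
Proof.
move=> I ht ew vw; have [un wn] := l_lt L ew.
have new i : i < tail -> q i != w.
  move=> it; apply/eqP => qw;
    have /(i_vis I wn) : exists2 i, i < tail & q i = w by exists i.
  by rewrite vw.
have qE i : i < tail -> upd q tail w i = q i by move=> it; rewrite upd_other //; lia.
have lE i : i < tail -> upd lev w (lev (q head) + 1) (q i) = lev (q i).
  by move=> it; rewrite upd_other // new.
have rE i : i < tail -> upd root w (root (q head)) (q i) = root (q i).
  by move=> it; rewrite upd_other // new.
have visw v : vis v != 0 -> v != w by apply: contra => /eqP->; rewrite vw.
have tailP i : i < tail + 1 -> i < tail \/ i = tail by lia.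
split.
- by have := i_head I; lia.
- exact: (i_r I).
- by move=> i /tailP[it|->]; rewrite ?upd_same ?qE //; apply: (i_q I).
- move=> i i' /tailP[it|->] /tailP[it'|->]; rewrite ?upd_same ?qE //.
  + exact: (i_inj I).
  + by move/eqP; rewrite (negbTE (new _ _)).
  + by move/esym/eqP; rewrite (negbTE (new _ _)).
- move=> v vn; have [->|vw'] := eqVneq v w.
    by rewrite upd_same; split=> // _; exists tail; rewrite ?upd_same //; lia.
  rewrite upd_other //; split=> [/(i_vis I vn)[i it qv]|[i /tailP[it|->]]].
  + by exists i; rewrite ?qE //; lia.
  + by rewrite qE // => qv; apply/(i_vis I vn); exists i.
  + by rewrite upd_same => /esym/eqP; rewrite (negbTE vw').
- move=> v /(i_roots I) hv; rewrite upd_other //; exact: visw.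
- by move=> _; rewrite qE //; apply: (i_cur I ht).
- move=> i i' ii' /tailP[it|it].
    by rewrite !qE ?lE //; [apply: (i_mono I ii' it) | lia | lia].
  rewrite it upd_same upd_same; case: (ltnP i tail) => it'.
    by rewrite qE ?lE //; have := i_near I it' ht; lia.
  have -> : i = tail by lia.
  by rewrite !upd_same.
- move=> i /tailP[it|->] _; rewrite ?(qE _ ht) ?(lE _ ht).
    by rewrite qE ?lE // (i_near I).
  by rewrite !upd_same addn1.
- move=> i hi /tailP[it|->]; rewrite ?(qE _ ht) ?(rE _ ht).
    by rewrite qE ?rE // (i_pend I).
  by rewrite !upd_same.
- move=> i /tailP[it|->].
    rewrite qE ?rE ?lE // upd_other ?new //.
    case: (i_par I it) => [h|[i' [ii' pi' ei' li']]]; [by left|right].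
    by exists i'; rewrite qE ?lE ?upd_other ?new //; lia.
  right; exists head; rewrite !upd_same qE // lE //; split=> //; lia.
- move=> i j' /tailP[it|->]; last by have := i_head I; lia.
  rewrite qE // lE // rE // => jr dn.
  have [sj vj lj rj] := i_done I it jr dn.
  have vw' := visw _ vj.
  by rewrite !upd_other.
- have ht' : head < tail + 1 by lia.
  case: (i_pot I) => [[? _]|h]; first lia.
  right; rewrite ht' qE // -h ht; congr (_ + _ + _).
  by apply: eq_bigr => i _; rewrite qE //; have := ltn_ord i; lia.
Qed.

Lemma bfs_scan q head tail j r vis lev par root src k :
    bfs_inv q head tail j r vis lev par root src k -> head < tail ->
    j < st (q head).+1 -> vis (dst j) != 0 ->
  bfs_inv q head tail (j + 1) r vis lev par root (upd src j (q head)) k.+1.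
Proof.
move=> I ht jh vd; have hn := i_q I ht.
have jr : st (q head) <= j < st (q head).+1 by rewrite jh; have := i_cur I ht; lia.
split; try by case: I.
- by move=> _; have := i_cur I ht; lia.
- have ew := l_slot L hn jr; have [_ wn] := l_lt L ew.
  move=> i j' it jr' dn; have [ej|jj'] := eqVneq j' j; last first.
    have [|sj vj lj rj] := i_done I it jr'; first by case/orP: dn => [->//|]; lia.
    by rewrite upd_other.
  move: jr' dn; rewrite ej => jr' dn.
  have qq : q i = q head by apply: slot_owner jr' jr => //; apply: (i_q I it).
  rewrite upd_same qq; have [i' it' qi'] := (i_vis I wn).1 vd.
  split=> //; first by rewrite -qi'; apply: (i_near I it' ht).
  (* A neighbour still in the queue has the root of the head; one already processed has scanned the
     reverse edge. *)
  have [hi'|hi'] := leqP head i'; first by rewrite -qi' (i_pend I).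
  have ew' : e (q i') (q head) by rewrite qi' (l_sym L).
  have [j'' jr'' dj''] := l_edge L ew'.
  have [|_ _ _] := i_done I it' jr''; first by rewrite hi'.
  by rewrite dj'' qi'.
- case: (i_pot I) => [[? _]|h]; first lia.
  by right; rewrite -h ht; have := i_cur I ht; lia.
Qed.

Lemma bfs_next q head tail j r vis lev par root src k j1 :
    bfs_inv q head tail j r vis lev par root src k -> head < tail ->
    st (q head).+1 <= j -> j1 = st (q (head + 1)) ->
  bfs_inv q (head + 1) tail j1 r vis lev par root src k.+1.
Proof.
move=> I ht jh ->; have hn := i_q I ht.
have jE : j = st (q head).+1 by have := i_cur I ht; lia.
have le := l_start_leq L hn.
split; try by case: I.
- by lia.
- by move=> ht'; rewrite leqnn /=; apply: (l_start_leq L); apply: (i_q I ht').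
- move=> i it ht'; apply: leq_trans (i_near I it ht) _; rewrite ltnS.
  by apply: (i_mono I _ ht'); lia.
- move=> i hi it; rewrite (i_pend I _ it); last lia.
  by rewrite (@i_pend _ _ _ _ _ _ _ _ _ _ _ I (head + 1)) //; lia.
- move=> i j' it jr dn; apply: (i_done I it jr).
  have [ei|ei] := eqVneq i head; last first.
    case/orP: dn; first lia.
    by case/andP => /eqP ei' jj; move: jr; rewrite ei' => /andP[h1 _]; lia.
  by move: jr; rewrite ei -jE => /andP[_ ->]; rewrite orbT.
- case: (i_pot I) => [[? _]|h]; first lia.
  right; rewrite subnn if_same addn0 addn1 big_ord_recr /= -h ht jE /deg.
  by move: (\sum_(i < head) _) => S; lia.
Qed.

Lemma bfs_root q head tail j r vis lev par root src k l p j1 :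
    bfs_inv q head tail j r vis lev par root src k -> head = tail -> r < n -> vis r = 0 ->
    l = lev (q (tail - 1)) -> p = n -> j1 = st r ->
  bfs_inv (upd q tail r) head (tail + 1) j1 r (upd vis r 1) (upd lev r l)
    (upd par r p) (upd root r r) src k.
Proof.
move=> I ht rn vr lE' -> ->.
have new i : i < tail -> q i != r.
  move=> it; apply/eqP => qw;
    have /(i_vis I rn) : exists2 i, i < tail & q i = r by exists i.
  by rewrite vr.
have qE i : i < tail -> upd q tail r i = q i by move=> it; rewrite upd_other //; lia.
have lE i : i < tail -> upd lev r l (q i) = lev (q i).
  by move=> it; rewrite upd_other // new.
have rE i : i < tail -> upd root r r (q i) = root (q i).
  by move=> it; rewrite upd_other // new.
have visw v : vis v != 0 -> v != r by apply: contra => /eqP->; rewrite vr.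
have tailP i : i < tail + 1 -> i < tail \/ i = tail by lia.
have top i : i < tail -> lev (q i) <= l.
  by move=> it; rewrite lE'; apply: (i_mono I _ _); lia.
split.
- by lia.
- exact: (i_r I).
- by move=> i /tailP[it|->]; rewrite ?upd_same ?qE //; apply: (i_q I).
- move=> i i' /tailP[it|->] /tailP[it'|->]; rewrite ?upd_same ?qE //.
  + exact: (i_inj I).
  + by move/eqP; rewrite (negbTE (new _ _)).
  + by move/esym/eqP; rewrite (negbTE (new _ _)).
- move=> v vn; have [->|vw'] := eqVneq v r.
    by rewrite upd_same; split=> // _; exists tail; rewrite ?upd_same //; lia.
  rewrite upd_other //; split=> [/(i_vis I vn)[i it qv]|[i /tailP[it|->]]].
  + by exists i; rewrite ?qE //; lia.
  + by rewrite qE // => qv; apply/(i_vis I vn); exists i.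
  + by rewrite upd_same => /esym/eqP; rewrite (negbTE vw').
- move=> v /(i_roots I) hv; rewrite upd_other //; exact: visw.
- by move=> _; rewrite ht upd_same leqnn /=; apply: (l_start_leq L).
- move=> i i' ii' /tailP[it|it].
    by rewrite !qE ?lE //; [apply: (i_mono I ii' it) | lia | lia].
  rewrite it upd_same upd_same; case: (ltnP i tail) => it'.
    by rewrite qE ?lE // top.
  have -> : i = tail by lia.
  by rewrite !upd_same.
- move=> i /tailP[it|->] _; rewrite ht !upd_same //.
  by rewrite qE ?lE //; have := top _ it; lia.
- move=> i hi /tailP[it|->]; first lia.
  by rewrite ht.
- move=> i /tailP[it|->]; last by left; rewrite !upd_same.
  rewrite qE ?rE ?lE // upd_other ?new //.
  case: (i_par I it) => [h|[i' [ii' pi' ei' li']]]; [by left|right].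
  by exists i'; rewrite qE ?lE ?upd_other ?new //; lia.
- move=> i j' /tailP[it|->]; last by rewrite ht upd_same; lia.
  rewrite qE // lE // rE // => jr dn.
  have [|sj vj lj rj] // := i_done I it jr; first by rewrite ht it.
  have vw' := visw _ vj.
  by rewrite !upd_other.
- case: (i_pot I) => [[_ ?]|h]; first lia.
  right; rewrite ht addn1 ltnSn upd_same subnn -h ht ltnn; congr (_ + _ + _).
  by apply: eq_bigr => i _; rewrite qE //; have := ltn_ord i; lia.
Qed.

Lemma bfs_root_next q head tail j r vis lev par root src k :
    bfs_inv q head tail j r vis lev par root src k -> r < n -> vis r != 0 ->
  bfs_inv q head tail j (r + 1) vis lev par root src k.+1.
Proof.
move=> I rn vr; split; try by case: I.
- by lia.
- move=> v; rewrite addn1 ltnS leq_eqVlt => /predU1P[->//|]; exact: (i_roots I).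
- by case: (i_pot I) => [[_ ?]|h]; [lia|right; lia].
Qed.

Lemma bfs_idle q head tail j r vis lev par root src k :
    bfs_inv q head tail j r vis lev par root src k -> head = tail -> n <= r ->
  bfs_inv q head tail j r vis lev par root src k.+1.
Proof.
by move=> I ht rn; split; try (by case: I); left; have := i_r I; lia.
Qed.

(** All that is kept of the search. Levels are not distances, because a later component may start at
    a positive level; only their differences matter. The queue order serves the colouring loop. *)
Record layering (M : nat) (q lev par root src : nat -> nat) : Prop := Layering {
  y_slot : forall j, j < M -> e (src j) (dst j);
  y_edge : forall u w, e u w -> exists j, [/\ j < M, src j = u & dst j = w];
  y_inj : forall j j', j < M -> j' < M -> src j = src j' -> dst j = dst j' -> j = j';
  y_lev : forall u w, e u w -> lev w <= (lev u).+1;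
  y_root : forall u w, e u w -> root w = root u;
  y_par : forall v, v < n -> (par v = n /\ root v = v) \/
    (e (par v) v /\ lev v = (lev (par v)).+1);
  y_queue : forall i, i < n -> q i < n;
  y_queue_inj : forall i i', i < n -> i' < n -> q i = q i' -> i = i';
  y_order : forall v, v < n -> exists i, [/\ i < n, q i = v &
    par v = n \/ exists2 i', i' < i & q i' = par v] }.

Lemma bfs_layering q head tail j r vis lev par root src :
    bfs_inv q head tail j r vis lev par root src (st n + 2 * n) ->
  layering (st n) q lev par root src.
Proof.
move=> I.
have tn : tail <= n by apply: inj_leq (i_q I) (i_inj I).
(* With a vertex still queued, the potential is below [st n + 2 * n]; with an empty queue, it has
   this value only if all roots were tried. *)
have [ht rn] : head = tail /\ r = n.
  case: (i_pot I) => // pot.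
  have sum_le : \sum_(i < tail) deg (q i) <= st n.
    by rewrite -sum_deg; apply: sum_inj_leq (i_q I) (i_inj I).
  have [ht|ht] := ltnP head tail; last first.
    have e1 : head = tail by have := i_head I; lia.
    have rn := i_r I; move: sum_le pot; rewrite e1 ltnn.
    by move: (\sum_(i < tail) _) => S; lia.
  have part : \sum_(i < head.+1) deg (q i) <= st n.
    rewrite -sum_deg; apply: sum_inj_leq => [i ih|i i' ih ih'].
      by apply: (i_q I); lia.
    by apply: (i_inj I); lia.
  move: part pot (i_cur I ht) (i_r I); rewrite big_ord_recr /= ht /deg.
  by move: (\sum_(i < head) _) => S; lia.
have all_vis v : v < n -> exists2 i, i < tail & q i = v.
  by move=> vn; apply/(i_vis I vn)/(i_roots I); rewrite rn.
have nt : n <= tail.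
  pose p v := if [pick i : 'I_tail | q i == v] is Some i then val i else 0.
  have pP v : v < n -> p v < tail /\ q (p v) = v.
    move=> vn; rewrite /p; case: pickP => [i' /eqP qi'|h]; first by rewrite /= qi' ltn_ord.
    by have [i' it' qi'] := all_vis v vn; have := h (Ordinal it'); rewrite /= qi' eqxx.
  apply: (@inj_leq p) => [v /pP[]//|v v' vn vn' pv].
  by rewrite -(pP v vn).2 pv (pP v' vn').2.
have slot u jj : u < n -> st u <= jj < st u.+1 ->
    [/\ src jj = u, lev (dst jj) <= (lev u).+1 & root (dst jj) = root u].
  move=> un jr; have [i it qi] := all_vis u un; rewrite -qi in jr *.
  by have [|? _ ? ?] := i_done I it jr; first by rewrite ht it.
have slot_lt u jj : u < n -> st u <= jj < st u.+1 -> jj < st n.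
  by move=> un /andP[_ h]; apply: leq_trans h (start_mono un _).
split.
- move=> jj /slot_exists[u un jr]; have [-> _ _] := slot _ _ un jr.
  exact: (l_slot L un jr).
- move=> u w ew; have [un _] := l_lt L ew; have [jj jr dj] := l_edge L ew.
  by exists jj; have [sj _ _] := slot _ _ un jr; split=> //; apply: slot_lt jr.
- move=> jj jj' /slot_exists[u un jr] /slot_exists[u' un' jr'].
  have [-> _ _] := slot _ _ un jr; have [-> _ _] := slot _ _ un' jr' => uu.
  by rewrite -uu in jr'; apply: (l_inj L un jr jr').
- move=> u w ew; have [un _] := l_lt L ew; have [jj jr <-] := l_edge L ew.
  by have [] := slot _ _ un jr.
- move=> u w ew; have [un _] := l_lt L ew; have [jj jr <-] := l_edge L ew.
  by have [] := slot _ _ un jr.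
- move=> v /all_vis[i it <-]; case: (i_par I it) => [|[i' [_ -> ei' li']]]; [by left|].
  by right.
- by move=> i iN; apply: (i_q I); apply: leq_trans iN nt.
- by move=> i i' iN iN'; apply: (i_inj I); lia.
- move=> v /all_vis[i it qi]; exists i; split=> //; first lia.
  rewrite -qi; case: (i_par I it) => [[]|[i' [ii' -> _ _]]]; [by left|].
  by right; exists i'.
Qed.

End Bfs.

Section Layers.
Variables (n M : nat) (e : rel nat) (dst q lev par root src : nat -> nat).
Hypothesis Y : layering n dst e M q lev par root src.
Hypothesis e_lt : forall u w, e u w -> u < n /\ w < n.

Lemma root_lev v : v < n ->
  [/\ root v < n, par (root v) = n, root (root v) = root v & root v = v \/ lev (root v)
    < lev v].
Proof.
have [k] := ubnP (lev v); elim: k v => // k IHk v; rewrite ltnS => lk vn.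
case: (y_par Y vn) => [[pv rv]|[ev lv]]; first by rewrite !rv; split=> //; left.
have [pn _] := e_lt ev; rewrite (y_root Y ev).
have [|? ? ? lr] := IHk _ _ pn; first by rewrite -ltnS -lv ltnS.
by split=> //; right; case: lr => [->|]; rewrite lv; lia.
Qed.

Lemma par_lt v : v < n -> root v <> v ->
  [/\ par v < n, e (par v) v & lev v = (lev (par v)).+1].
Proof. by move=> vn rv; case: (y_par Y vn) => [[]//|[ev lv]]; have [] := e_lt ev. Qed.

(** A root is on the lowest level of its component. *)
Lemma root_not_below x v : e x v -> lev v = (lev x).+1 -> root v <> v.
Proof.
move=> ev lv rv; have [xn vn] := e_lt ev.
have := y_root Y ev; rewrite rv => rx.
have [_ _ _] := root_lev xn; rewrite -rx => -[vE|]; last lia.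
by move: lv; rewrite -vE; lia.
Qed.

End Layers.

Section BfsLoop.
Variables (n M : nat) (e : rel nat) (s0 : store).
Hypothesis s0n : s0 0 0 = n.
Hypothesis s0M : s0 1 n = M.
Hypothesis s0z : forall a j, 2 < a -> s0 a j = 0.
Hypothesis LS : lists n (s0 1) (s0 2) e.

Definition bfs_ok (s : store) k := bfs_inv n (s0 1) (s0 2) e (s 8) (s 4 0) (s 5 0) (s 6
  0) (s 7 0)
  (s 9) (s 10) (s 11) (s 12) (s 13) k.

Lemma bfs_step s k : s 0 0 = n -> s 1 =1 s0 1 -> s 2 =1 s0 2 -> bfs_ok s k ->
  bfs_ok (den bfs_code s) k.+1.
Proof.
move=> sn s1 s2 I; rewrite /=; case: ltnP => ht; last first.
  have {}ht : s 4 0 = s 5 0 by apply/eqP; rewrite eqn_leq ht (i_head I).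
  rewrite sn; case: ltnP => rn; last exact: bfs_idle I ht rn.
  case: eqP => vr; last by apply: (bfs_root_next I); last apply/eqP.
  have := bfs_root LS I ht rn vr (erefl _) sn (s1 (s 7 0)).
  by move/bfs_root_next; apply; rewrite ?upd_same.
rewrite s1 addn1; case: ltnP => js; last first.
  exact: (bfs_next LS I ht js (s1 _)).
have hn := i_q I ht.
have ew : e (s 8 (s 4 0)) (s 2 (s 6 0)).
  by rewrite s2; apply: (l_slot LS hn); rewrite js; have /andP[->] := i_cur I ht.
case: eqP => vw; last first.
  by apply: (bfs_scan LS I ht js); rewrite -s2; apply/eqP.
have I' := bfs_push LS I ht ew vw.
have qh : upd (s 8) (s 5 0) (s 2 (s 6 0)) (s 4 0) = s 8 (s 4 0)
  by rewrite upd_other //; lia.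
apply: (bfs_scan LS I'); first by lia.
  by rewrite qh.
by rewrite -s2 upd_same.
Qed.

Let s1 := for_den bfs_code (M + (n + n)) s0.

Lemma bfs_frame k a j : a \in [:: 0; 1; 2] -> for_den bfs_code k s0 a j = s0 a j.
Proof. by rewrite !inE => /or3P[] /eqP->; rewrite for_den_frame. Qed.

Lemma bfs_invariant k : bfs_ok (for_den bfs_code k s0) k.
Proof.
elim: k => [|k IHk]; last by apply: bfs_step IHk => [|j|j]; rewrite bfs_frame.
have z a j : 2 < a -> for_den bfs_code 0 s0 a j = 0.
  by move=> a2; rewrite /= /update s0z //; case: ifP.
rewrite /bfs_ok !z //; split; rewrite ?z //.
- by move=> v vn; rewrite z //; split=> // -[].
- by right; rewrite ltnn big_ord0.
Qed.

Lemma layering_agree q q' dst dst' lev lev' par par' root root' src src' :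
    q =1 q' -> dst =1 dst' -> lev =1 lev' -> par =1 par' -> root =1 root' -> src =1 src' ->
  layering n dst e M q lev par root src -> layering n dst' e M q' lev' par' root' src'.
Proof.
move=> qE dE lE pE rE sE [h1 h2 h3 h4 h5 h6 h7 h7' h8]; split.
- by move=> j /h1; rewrite sE dE.
- by move=> u w /h2[j [jM sj dj]]; exists j; rewrite -sE -dE.
- by move=> j j' jM jM'; rewrite -!sE -!dE; apply: h3.
- by move=> u w /h4; rewrite !lE.
- by move=> u w /h5; rewrite !rE.
- by move=> v /h6; rewrite pE rE !lE.
- by move=> k /h7; rewrite qE.
- by move=> k k' kn kn'; rewrite -!qE; apply: h7'.
- move=> v /h8[k [kn qk pk]]; exists k; rewrite -qE -pE; split=> //.
  by case: pk => [->|[k' kk qk']]; [left|right; exists k'; rewrite -?qE].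
Qed.

End BfsLoop.

(** * Block graphs *)

Section Blocks.
Variable T : finType.
Implicit Types (G H B : graph T) (x y z : T) (S : {set T}).

Lemma adjacent_sym G : symmetric (adjacent G).
Proof. by move=> x y; rewrite /adjacent /= setUC. Qed.

Lemma adjacent_verts G x y : adjacent G x y -> [/\ x \in verts G, y \in verts G & x != y].
Proof.
move=> /(forall_inP (graphP G)) /andP[/subsetP sV]; rewrite cards2.
have [//|xy _] := eqVneq x y.
by split=> //; apply: sV; rewrite !inE eqxx ?orbT.
Qed.

Lemma adjacent_del G x y z :
  adjacent (del_vertex G x) y z = [&& adjacent G y z, x != y & x != z].
Proof. by rewrite /adjacent /= !inE negb_or. Qed.

Lemma connect_leave (e : rel T) (C : pred T) x y :
  connect e x y -> C x -> ~~ C y -> exists u w, [/\ C u, ~~ C w & e u w].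
Proof.
case/connectP=> p; elim: p x => [|z p IHp] x /=; first by move=> _ -> ->.
case/andP=> xz pz ey Cx Cy; have [Cz|Cz] := boolP (C z); first exact: IHp pz ey Cz Cy.
by exists x, z.
Qed.

Lemma induced_subproof G S :
  [forall e in [set e in edges G | e \subset S], (e \subset S) && (#|e| == 2)].
Proof.
apply/forall_inP => e; rewrite inE => /andP[eG ->].
by have /andP[_ ->] := forall_inP (graphP G) e eG.
Qed.

Definition induced G S : graph T := Graph (induced_subproof G S).

Lemma adjacent_induced G S x y :
  adjacent (induced G S) x y = [&& adjacent G x y, x \in S & y \in S].
Proof. by rewrite /adjacent /= inE subUset !sub1set. Qed.

Lemma induced_subgraph G S : S \subset verts G -> subgraph (induced G S) G.
Proof. by split=> //; apply/subsetP => e; rewrite inE => /andP[]. Qed.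

(** Rotate the cycle to start at the vertex to be deleted: the rest is a path, hence connected. *)
Lemma cycle_nonseparable G c : cycle (adjacent G) c -> uniq c -> 1 < size c ->
  nonseparable (induced G [set x in c]).
Proof.
move=> cc uc sc; set H := induced _ _.
have sym K := sym_connect_sym (@adjacent_sym K).
have inH x y : x \in c -> y \in c -> adjacent G x y -> adjacent H x y.
  by move=> xc yc xy; rewrite adjacent_induced xy !inE xc.
have rotc x : x \in c ->
  exists p, [/\ cycle (adjacent G) (x :: p), uniq (x :: p) & x :: p =i c].
  move=> /rot_to[i p ep]; exists p; rewrite -ep rot_cycle rot_uniq; split=> // y.
  by rewrite mem_rot.
split; first split.
- by rewrite /H; case: c sc {H cc uc rotc inH} => // x c _; apply/set0Pn; exists x;
    rewrite !inE eqxx.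
- move=> x y; rewrite !inE => /rotc[p [cp _ pc]]; rewrite -pc => yp.
  have : path (adjacent H) x p.
    move: cp; rewrite /= rcons_path => /andP[cp _].
    apply: (sub_in_path (P := [in c])) cp; last by apply/allP => z; rewrite pc.
    by move=> u w uc' wc'; apply: inH.
  by move/path_connect; apply.
- move=> x [xH [y [z [yH zH _ /negP]]]]; apply.
  have xc : x \in c by move: xH; rewrite inE.
  have [p [cp up pc]] := rotc x xc.
  case: p cp up pc => [|w p] cp up pc.
    by move: yH; rewrite !inE -pc inE; case: eqP.
  have pw : path (adjacent (del_vertex H x)) w p.
    move: cp; rewrite /= rcons_path => /and3P[_ cp _].
    apply: (sub_in_path (P := [in w :: p])) cp; last by apply/allP.
    have sub u : u \in w :: p -> u \in c /\ x != u.
      move=> uwp; rewrite -pc inE uwp orbT; split=> //.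
      by move: up => /= /andP[xp _]; apply: contra xp => /eqP->.
    by move=> u v /sub[uc' xu] /sub[vc' xv] uv; rewrite adjacent_del inH ?xu.
  have wp v : v \in verts H :\ x -> connect (adjacent (del_vertex H x)) w v.
    by rewrite !inE -pc inE => /andP[/negbTE-> /=]; apply: path_connect.
  by apply: connect_trans (wp z zH); rewrite sym; apply: wp.
Qed.

Lemma complete_nonseparable H : verts H != set0 -> complete H -> nonseparable H.
Proof.
move=> H0 cH; split; first split=> // x y xH yH.
  by have [->|xy] := eqVneq x y; [apply: connect0 | apply/connect1/cH].
move=> x [_ [y [z [+ + _ /negP]]]]; rewrite !inE => /andP[yx yH] /andP[zx zH]; apply.
have [->|yz] := eqVneq y z; [exact: connect0 | apply: connect1].
by rewrite adjacent_del cH // ![x == _]eq_sym yx.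
Qed.

Lemma subgraph_adjacent H G x y : subgraph H G -> adjacent H x y -> adjacent G x y.
Proof. by case=> _ /subsetP s; apply: s. Qed.

(** A nonseparable subgraph that is not maximal lies in a larger one. The induction on what is left
    of [G] ends in a block, which is complete. *)
Lemma nonseparable_adjacent G H x y : block_graph G -> subgraph H G -> nonseparable H ->
  x \in verts H -> y \in verts H -> x != y -> adjacent G x y.
Proof.
move=> bG; have [k] := ubnP (#|verts G| + #|edges G| - (#|verts H| + #|edges H|)).
elim: k H => // k IHk H; rewrite ltnS => Hk HG nH xH yH xy.
have [//|nxy] := boolP (adjacent G x y).
suff bH : is_block G H.
  by move: nxy; rewrite (subgraph_adjacent HG) //; apply: bG bH _ _ xH yH xy.
split=> // H' H'G nH' [HV HE].
have [/andP[//]|] := boolP ((verts H' \subset verts H) && (edges H' \subset edges H)).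
rewrite negb_and => larger; exfalso; apply/negP: nxy; rewrite negbK.
apply: (IHk H') => //; try exact: (subsetP HV).
apply: leq_trans Hk; case: H'G => /subset_leq_card le1 /subset_leq_card le2.
have [le3 le4] := (subset_leq_card HV, subset_leq_card HE).
case/orP: larger => [nV|nE].
  have : verts H \proper verts H' by rewrite properE HV.
  by move/proper_card; lia.
have : edges H \proper edges H' by rewrite properE HE.
by move/proper_card; lia.
Qed.

(* A path that avoids x between two neighbours of x closes to a cycle through x. *)
Lemma block_graph_neighbours G x a b : block_graph G ->
  adjacent G x a -> adjacent G x b -> a != b ->
  connect (adjacent (del_vertex G x)) a b -> adjacent G a b.
Proof.
move=> bG xa xb ab /connectP[p0 pth eb]; case/shortenP: pth eb => p pp up _ eb.
have ax : a != x by have [_ _] := adjacent_verts xa; rewrite eq_sym.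
have avoid : x \notin a :: p.
  apply/negP => /(path_connect pp) /(connect_leave (C := predC1 x)) /= /(_ ax).
  by rewrite eqxx => /(_ erefl)[u [w [_ /negPn/eqP-> ]]]; rewrite adjacent_del eqxx !andbF.
pose c := x :: a :: p.
have cc : cycle (adjacent G) c.
  rewrite /= xa /= rcons_path -eb adjacent_sym xb andbT.
  by apply: sub_path pp => u w; rewrite adjacent_del => /andP[].
have uc : uniq c by rewrite cons_uniq avoid.
have cV : [set y in c] \subset verts G.
  apply/subsetP => y; rewrite inE => yc; have := next_cycle cc yc.
  by case/adjacent_verts.
apply: (nonseparable_adjacent bG (induced_subgraph cV)) => //.
- exact: cycle_nonseparable.
- by rewrite !inE eqxx orbT.
- by rewrite inE eb; rewrite inE mem_last orbT.
Qed.

(** * The block graph whose cliques are the classes with their tops *)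

Variables (V : {set T}) (cls lev : T -> nat) (top : rel T).
Hypothesis top_cls : {in V & V, forall x y u, cls x = cls y -> top u x -> top u y}.
Hypothesis top_uniq : {in V &, forall u u' x, top u x -> top u' x -> u = u'}.
Hypothesis top_lev : forall u x, top u x -> lev u < lev x.

Definition fill_rel : rel T :=
  [rel x y | [&& x \in V, y \in V, x != y & [|| cls x == cls y, top x y | top y x]]].

Lemma fill_sym : symmetric fill_rel.
Proof.
move=> x y; rewrite /fill_rel /= andbCA (eq_sym x) (eq_sym (cls x)).
by rewrite (orbC (top x y)).
Qed.

Lemma fill_subproof :
  [forall e in [set e : {set T} | [exists x, exists y, fill_rel x y && (e == [set x; y])]],
     (e \subset V) && (#|e| == 2)].
Proof.
apply/forall_inP => e;
  rewrite inE => /existsP[x /existsP[y /andP[/and4P[xV yV xy _] /eqP->]]].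
by rewrite subUset !sub1set xV yV cards2 xy.
Qed.

Definition fill : graph T := Graph fill_subproof.

Lemma adjacent_fill : adjacent fill =2 fill_rel.
Proof.
move=> x y; rewrite {1}/adjacent /= inE; apply/idP/idP => [|xy]; last first.
  by apply/existsP; exists x; apply/existsP; exists y; rewrite xy eqxx.
case/existsP=> u /existsP[w /andP[uw /eqP e]].
have uxy : u \in [set x; y] by rewrite e !inE eqxx.
have wxy : w \in [set x; y] by rewrite e !inE eqxx orbT.
have /and4P[_ _ uw' _] := uw.
case/set2P: uxy uw uw' => ->; case/set2P: wxy => ->; rewrite ?eqxx //.
by rewrite fill_sym.
Qed.

(** In a block, take a vertex [v] whose top is deepest. Edges of the block that leave the class of
    [v] end in the top of [v], which would be a cut vertex if the block reached further. So the
    block lies in the clique of the class and its top. *)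
Lemma fill_block_graph : block_graph fill.
Proof.
move=> B [BF nB maxB]; have [[/set0Pn[v0 v0B] conB] cutB] := nB.
have BV : verts B \subset V by case: BF.
have BVp x : x \in verts B -> x \in V by apply: (subsetP BV).
(* The successor separates a top on level 0 from no top. *)
pose height x := if [pick u in V | top u x] is Some u then (lev u).+1 else 0.
have heightP u x : u \in V -> x \in V -> top u x -> height x = (lev u).+1.
  move=> uV xV ux; rewrite /height; case: pickP => [w /andP[wV wx]|/(_ u)].
    by rewrite (top_uniq uV wV ux wx).
  by rewrite uV ux.
have height_leq x : height x <= lev x.
  by rewrite /height; case: pickP => // w /andP[_ /top_lev].
have height_cls x y : x \in V -> y \in V -> cls x = cls y -> height x = height y.
  move=> xV yV xy; rewrite /height; congr (if _ is Some u then _ else _).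
  by apply: eq_pick => u; congr (_ && _); apply/idP/idP; apply: top_cls.
case: (arg_maxnP height v0B) => v vB' maxv; have vB : v \in verts B := vB'.
have leave x z : x \in verts B -> cls x = cls v -> cls z != cls v -> adjacent B x z ->
  top z v.
  move=> xB xv zv xz; have [_ zB _] := adjacent_verts xz.
  have := subgraph_adjacent BF xz; rewrite adjacent_fill => /and4P[_ _ _].
  (* If [x] were the top of [z], then [height z] would be [(lev x).+1], which exceeds the maximum
     [height v = height x]. *)
  rewrite xv eq_sym (negbTE zv) /= => /orP[xz'|zx].
    have hz : height z <= height v := maxv _ zB.
    have := height_leq x; rewrite (height_cls x v) ?BVp //.
    by move: hz; rewrite (heightP x) ?BVp //; lia.
  by apply: top_cls zx; rewrite ?BVp.
pose K := [set y in V | (cls y == cls v) || top y v].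
have BK : verts B \subset K.
  apply/subsetP => x xB; rewrite inE BVp //=; apply/negP => /negP;
    rewrite negb_or => /andP[xv nxv].
  have vx := conB _ _ vB xB.
  have [u [z [/eqP uv zv uz]]] := connect_leave (C := fun y =>
    cls y == cls v) vx (eqxx _) xv.
  have [uB zB _] := adjacent_verts uz.
  have zt := leave _ _ uB uv zv uz.
  (* The vertex [z] separates [v] from [x]: a path that avoids it would leave the class through some
     [z'], but [leave] makes [z'] the top of [v] as well. *)
  apply: (cutB z); split=> //; exists v, x; rewrite !in_setD1 vB xB !andbT; split=> //.
  - by apply: contra zv => /eqP->.
  - by apply: contra nxv => /eqP->.
  - apply/negP => vx'.
    have [u' [z' [/eqP uv' zv' uz']]] := connect_leave (C := fun y =>
      cls y == cls v) vx' (eqxx _) xv.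
    move: uz'; rewrite adjacent_del => /and3P[uz' _ /eqP]; apply.
    have [uB' zB' _] := adjacent_verts uz'.
    by apply: (top_uniq _ _ zt (leave _ _ uB' uv' zv' uz')); rewrite ?BVp.
have Kadj x y : x \in K -> y \in K -> x != y -> adjacent fill x y.
  rewrite !inE adjacent_fill /fill_rel /= => /andP[xV xK] /andP[yV yK] xy;
    rewrite xV yV xy /=.
  have vV := BVp v vB.
  case/orP: xK => [/eqP xv|xv]; case/orP: yK => [/eqP yv|yv].
  - by rewrite xv yv eqxx.
  - by rewrite (top_cls vV xV _ yv) ?xv ?orbT.
  - by rewrite (top_cls vV yV _ xv) ?yv ?orbT.
  - by move: xy; rewrite (top_uniq xV yV xv yv) eqxx.
pose H := induced fill K.
have cH : complete H.
  by move=> x y xK yK xy; rewrite adjacent_induced; apply/and3P; split=> //; apply: Kadj.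
have HB : subgraph H B.
  apply: maxB.
  - by apply: induced_subgraph; apply/subsetP => x; rewrite inE => /andP[].
  - by apply: complete_nonseparable => //; apply/set0Pn; exists v; apply: (subsetP BK).
  split=> //; apply/subsetP => e eB; rewrite inE; case: BF => _ /subsetP -> //=.
  by have /andP[eBV _] := forall_inP (graphP B) e eB; apply: subset_trans BK.
move=> x y xB yB xy; apply: (subgraph_adjacent HB).
by apply: cH => //; apply: (subsetP BK).
Qed.

End Blocks.

(** * What the program computes *)

Section Spec.
Variables (n M : nat) (e : rel nat) (s : store).

Local Notation dst := (s 2).
Local Notation lev := (s 10).
Local Notation par := (s 11).
Local Notation src := (s 13).
Local Notation mult := (s 14).
Local Notation top := (s 15).
Local Notation r1 := (s 17).
Local Notation r2 := (s 19).
Local Notation mk := (s 21).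
Local Notation mv := (s 22).
Local Notation sm := (s 24).
Local Notation dm := (s 25).
Local Notation deg := (s 27).
Local Notation sz := (s 28).
Local Notation sg := (s 29).
Local Notation hasF := (s 30).
Local Notation anyF := (s 31).
Local Notation db := (s 32).
Local Notation ref := (s 33).
Local Notation ar := (s 34).
Local Notation col := (s 35).

Definition nonuniv m := (deg m).+1 != sz (mk m).
Definition single v := (sg v != 0) && (db v == 0).
Definition lab1 v := (db v != 0) || (sg v != 0) && (col v == 0).
Definition lab2 v := (db v != 0) || (sg v != 0) && (col v != 0).
Definition share v w := (lab1 v && lab1 w) || (lab2 v && lab2 w).
(** The number of members that share a label with [m]. It includes [m] itself, so that it is 1 if
    [m] has no label. *)
Definition sharing m :=
  if lab1 (mv m) then if lab2 (mv m) then s 39 (mk m) else s 37 (mk m)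
  else if lab2 (mv m) then s 38 (mk m) else 1.

(** The interface between program and graph theory: the final store solves these equations, and
    soundness and completeness use nothing else about the loops. *)
Record results : Prop := Results {
  c_lay : layering n dst e M (s 8) lev par (s 12) src;
  c_mult w : mult w != 0 <-> exists j, [/\ j < M, dst j = w, lev w = (lev (src j)).+1 &
    par w <> src j];
  c_top v : v < n -> top v = if mult v != 0 then par (par v) else par v;
  c_r1 v : v < n -> [/\ v <= r1 v,
    forall j, j < M -> src j = v -> top (src j) = top (dst j) -> dst j <= r1 v &
    r1 v = v \/ exists j, [/\ j < M, src j = v, top (src j) = top (dst j) & r1 v = dst j]];
  c_r2 v : v < n -> [/\ r1 v <= r2 v,
    forall j, j < M -> src j = v -> top (src j) = top (dst j) -> r1 (dst j) <= r2 v &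
    r2 v = r1 v \/ exists j, [/\ j < M, src j = v, top (src j) = top (dst j) & r2 v =
      r1 (dst j)]];
  c_mkl v : v < n -> mk v = r2 v;
  c_mkr v : v < n -> mk (n + v) = if top v < n then v else n + v;
  c_mvl v : v < n -> mv v = v;
  c_mvr v : v < n -> mv (n + v) = top v;
  c_sm j : j < M -> sm j = if (r2 (src j) != r2 (dst j)) && (src j == top (dst j))
    then n + r2 (dst j) else src j;
  c_dm j : j < M -> dm j = if (r2 (src j) != r2 (dst j)) && (dst j == top (src j))
    then n + r2 (src j) else dst j;
  c_deg m : deg m = count (fun j => sm j == m) (iota 0 M);
  c_sz k : sz k = count (fun m => mk m == k) (iota 0 (n + n));
  c_sg v : sg v != 0 <-> exists m, [/\ m < n + n, nonuniv m & mv m = v];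
  c_has m : hasF m != 0 <-> exists j, [/\ j < M, nonuniv (sm j), nonuniv (dm j) & sm j = m];
  c_any k : anyF k != 0 <-> exists j, [/\ j < M, nonuniv (sm j), nonuniv (dm j) & mk
    (sm j) = k];
  c_db v : db v != 0 <->
    exists m, [/\ m < n + n, nonuniv m, hasF m = 0, anyF (mk m) != 0 & mv m = v];
  c_ref k : (ref k = 0 /\ forall m, m < n + n -> mk m = k -> ~~ single (mv m)) \/
    (exists m0, [/\ m0 < n + n, ref k = m0.+1, mk m0 = k, single (mv m0) &
      forall m, m < n + n -> mk m = k -> single (mv m) -> m <= m0]);
  c_ar m : ar m != 0 <-> exists j, [/\ j < M, ref (mk (sm j)) = (sm j).+1 & dm j = m];
  c_ar1 m : ar m <= 1;
  c_col v : v < n -> col v = ~~ (ar v == col (top v));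
  c_col1 v : col v <= 1;
  c_s1 k : s 37 k = count (fun m => (mk m == k) && lab1 (mv m)) (iota 0 (n + n));
  c_s2 k : s 38 k = count (fun m => (mk m == k) && lab2 (mv m)) (iota 0 (n + n));
  c_s12 k : s 39 k = count (fun m =>
    (mk m == k) && (lab1 (mv m) || lab2 (mv m))) (iota 0 (n + n));
  c_b1 : s 20 0 = 0 <-> forall v, v < n -> top (r2 v) = top v;
  c_b2 : s 26 0 = 0 <-> forall j, j < M -> mk (sm j) = mk (dm j);
  c_b3 : s 36 0 = 0 <-> forall j, j < M -> ~~ share (src j) (dst j);
  c_b4 : s 40 0 = 0 <-> forall m, m < n + n -> deg m + sharing m = sz (mk m) }.

Hypothesis C : results.
Hypothesis e_lt : forall u w, e u w -> u < n /\ w < n.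
Hypothesis e_sym : symmetric e.
Hypothesis e_irr : irreflexive e.

Let Y := c_lay C.

Lemma slot_e j : j < M -> e (src j) (dst j). Proof. exact: (y_slot Y). Qed.
Lemma slot_lt j : j < M -> src j < n /\ dst j < n.
Proof. by move=> /slot_e /e_lt. Qed.

Lemma r1_lt v : v < n -> r1 v < n.
Proof.
move=> vn; have [_ _ [->//|[j [jM _ _ ->]]]] := c_r1 C vn.
by have [] := slot_lt jM.
Qed.

Lemma r2_lt v : v < n -> r2 v < n.
Proof.
move=> vn; have [_ _ [->|[j [jM _ _ ->]]]] := c_r2 C vn; first exact: r1_lt.
by apply: r1_lt; have [] := slot_lt jM.
Qed.

Lemma sm_lt j : j < M -> sm j < n + n.
Proof.
move=> jM; have [sn dn] := slot_lt jM; rewrite (c_sm C jM).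
by case: ifP => _; have := r2_lt dn; lia.
Qed.

Lemma dm_lt j : j < M -> dm j < n + n.
Proof.
move=> jM; have [sn dn] := slot_lt jM; rewrite (c_dm C jM).
by case: ifP => _; have := r2_lt sn; lia.
Qed.

Hypothesis top_r2 : forall v, v < n -> top (r2 v) = top v.

Lemma mv_sm j : j < M -> mv (sm j) = src j.
Proof.
move=> jM; have [sn dn] := slot_lt jM; rewrite (c_sm C jM).
case: ifP => [/andP[_ /eqP->]|_]; last exact: c_mvl.
by rewrite (c_mvr C (r2_lt dn)) top_r2.
Qed.

Lemma mv_dm j : j < M -> mv (dm j) = dst j.
Proof.
move=> jM; have [sn dn] := slot_lt jM; rewrite (c_dm C jM).
case: ifP => [/andP[_ /eqP->]|_]; last exact: c_mvl.
by rewrite (c_mvr C (r2_lt sn)) top_r2.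
Qed.

Definition nb m m' := has (fun j => (sm j == m) && (dm j == m')) (iota 0 M).

Lemma nbP m m' : reflect (exists j, [/\ j < M, sm j = m & dm j = m']) (nb m m').
Proof.
apply: (iffP hasP) => [[j]|[j [jM <- <-]]].
  by rewrite mem_iota => /= jM /andP[/eqP sj /eqP dj]; exists j.
by exists j; rewrite ?mem_iota ?eqxx.
Qed.

Lemma nb_irr m : nb m m = false.
Proof.
apply/negP => /nbP[j [jM sj dj]]; have := slot_e jM.
by rewrite -mv_sm // -mv_dm // sj dj e_irr.
Qed.

(** No edge is listed twice in the same direction, so distinct slots of a member lead to distinct
    members, and counting slots counts neighbours. *)
Lemma deg_count m : deg m = count (nb m) (iota 0 (n + n)).
Proof.
rewrite (c_deg C) -size_filter -(size_map dm) -[RHS]size_filter.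
apply/perm_size/uniq_perm; last 2 first.
- by rewrite filter_uniq // iota_uniq.
- move=> m'; rewrite mem_filter mem_iota /=; apply/mapP/andP.
    case=> j; rewrite mem_filter mem_iota /= => /andP[/eqP sj jM] ->.
    by split; [apply/nbP; exists j | apply: dm_lt].
  by case=> /nbP[j [jM sj <-]] _; exists j; rewrite // mem_filter mem_iota sj eqxx.
rewrite map_inj_in_uniq ?filter_uniq ?iota_uniq // => j j'.
rewrite !mem_filter !mem_iota => /andP[/eqP sj /= jM] /andP[/eqP sj' /= jM'] dd.
by apply: (y_inj Y) => //; rewrite -?mv_sm -?mv_dm // ?sj ?sj' ?dd.
Qed.

Lemma sharing_count m : m < n + n ->
  sharing m = count (fun m' =>
    (mk m' == mk m) && ((m' == m) || share (mv m) (mv m'))) (iota 0 (n + n)).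
Proof.
move=> mn; rewrite /sharing /share; case E1: (lab1 (mv m)); case E2: (lab2 (mv m)).
- rewrite (c_s12 C); apply: eq_count => m' /=; congr (_ && _).
  by case: eqP => // ->; rewrite E1.
- rewrite (c_s1 C); apply: eq_count => m' /=; congr (_ && _); rewrite orbF.
  by case: eqP => // ->; rewrite E1.
- rewrite (c_s2 C); apply: eq_count => m' /=; congr (_ && _).
  by case: eqP => // ->; rewrite E2.
- transitivity (count_mem m (iota 0 (n + n)));
    first by rewrite count_uniq_mem ?iota_uniq // mem_iota mn.
  by apply: eq_count => m' /=; rewrite orbF; have [->|_] := eqVneq m' m;
    rewrite ?eqxx ?andbF.
Qed.

(** Nested predicates with equal counts agree. Comparing two counters thus replaces a test of all
    pairs of members, which linear time would not allow. *)
Lemma sub_count_all (a b : pred nat) r : subpred a b ->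
  (count a r == count b r) = all (fun x => b x ==> a x) r.
Proof.
move=> ab; elim: r => //= x r <-; have le := sub_count ab r.
have := ab x; case: (a x) => [/(_ isT)->|_]; first by rewrite eqn_add2l.
by case: (b x) => //=; apply/negbTE; rewrite neq_ltn; lia.
Qed.

Hypothesis mk_slot : forall j, j < M -> mk (sm j) = mk (dm j).

Lemma nb_mk m m' : nb m m' -> mk m' = mk m.
Proof. by move=> /nbP[j [jM <- <-]]; rewrite mk_slot. Qed.

Lemma nonunivP m : m < n + n ->
  reflect (exists m', [/\ m' < n + n, mk m' = mk m, m' != m & ~~ nb m m']) (nonuniv m).
Proof.
move=> mn; have -> : nonuniv m = ~~ all (fun m' =>
  (mk m' == mk m) ==> (m' == m) || nb m m') (iota 0 (n + n)).
  rewrite -sub_count_all => [|m' /orP[/eqP->|/nb_mk->]//];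
    rewrite /nonuniv (c_sz C) deg_count.
  congr (_ != _); have := count_predUI (pred1 m) (nb m) (iota 0 (n + n)).
  rewrite (eq_count (a1 := predI _ _) (a2 := pred0)) => [|m' /=]; last first.
    by case: eqP => [->|//]; rewrite nb_irr.
  by rewrite count_pred0 addn0 count_uniq_mem ?iota_uniq // mem_iota /= mn add1n => <-.
apply: (iffP allPn) => [[m']|[m' [mn' mkE mm' nm]]].
  by rewrite mem_iota /= negb_imply negb_or => mn' /and3P[/eqP ? ? ?]; exists m'.
by exists m'; rewrite ?mem_iota // negb_imply negb_or mkE eqxx mm'.
Qed.

Hypothesis share_slot : forall j, j < M -> ~~ share (src j) (dst j).

Lemma nb_share m m' : nb m m' -> ~~ share (mv m) (mv m').
Proof. by move=> /nbP[j [jM <- <-]]; rewrite mv_sm ?mv_dm // share_slot. Qed.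

(** Neighbours share no label with [m], so the two counts of the check add up to the size of a union
    inside the class. *)
Lemma sharingP m : m < n + n ->
  reflect (forall m', m' < n + n -> mk m' = mk m -> m' != m ->
    nb m m' || share (mv m) (mv m'))
    (deg m + sharing m == sz (mk m)).
Proof.
move=> mn; pose a m' := nb m m' || (mk m' == mk m) && ((m' == m) || share (mv m) (mv m')).
have -> : deg m + sharing m = count a (iota 0 (n + n)).
  rewrite deg_count sharing_count //; set b := (X in count (nb m) _ + count X _).
  have := count_predUI (nb m) b (iota 0 (n + n)).
  rewrite (eq_count (a1 := predI _ _) (a2 := pred0)) => [|m' /=]; last first.
    apply/negP => /andP[mm /andP[_ /orP[/eqP em|sh]]]; first by rewrite em nb_irr in mm.
    by have := nb_share mm; rewrite sh.
  by rewrite count_pred0 addn0.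
rewrite (c_sz C) sub_count_all => [|m' /orP[/nb_mk->|/andP[]]//].
apply: (iffP allP) => h m'.
  move=> mn' mkE /negbTE mm'; have := h m'; rewrite mem_iota mn' /a mkE eqxx mm' /=.
  by apply.
rewrite mem_iota /= => mn'; apply/implyP => /eqP mkE; rewrite /a mkE eqxx /=.
by have [//|mm'] := eqVneq m' m; rewrite ?orbT //; have := h m' mn' mkE mm'.
Qed.

End Spec.

(** * Accepted graphs are 2-probe block graphs *)

Section Sound.
Variables (n M : nat) (e : rel nat) (s : store).
Hypothesis C : results n M e s.
Hypothesis e_lt : forall u w, e u w -> u < n /\ w < n.
Hypothesis e_sym : symmetric e.
Hypothesis e_irr : irreflexive e.

Local Notation dst := (s 2).
Local Notation lev := (s 10).
Local Notation par := (s 11).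
Local Notation root := (s 12).
Local Notation src := (s 13).
Local Notation mult := (s 14).
Local Notation top := (s 15).
Local Notation r2 := (s 19).
Local Notation mk := (s 21).
Local Notation mv := (s 22).

Let Y := c_lay C.

Lemma mult_root v : v < n -> mult v != 0 -> root v <> v.
Proof.
move=> vn /(c_mult C)[j [jM dj lv _]]; have := y_slot Y jM; rewrite dj => ev.
exact: (root_not_below Y e_lt ev lv).
Qed.

Lemma top_lev v : v < n -> top v < n -> lev (top v) < lev v.
Proof.
move=> vn; rewrite (c_top C vn); case: ifPn => [mv tn|_ tn]; last first.
  by case: (y_par Y vn) => [[pv _]|[_ ->//]]; rewrite pv ltnn in tn.
have [pn ev ->] := par_lt Y e_lt vn (mult_root vn mv).
case: (y_par Y pn) => [[pv _]|[_ ->]]; first by rewrite pv ltnn in tn.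
exact: leqW.
Qed.

Hypothesis top_r2 : forall v, v < n -> top (r2 v) = top v.
Hypothesis mk_slot : forall j, j < M -> mk (s 24 j) = mk (s 25 j).

Lemma edge_class u w : e u w -> [\/ r2 u = r2 w, u = top w | w = top u].
Proof.
move=> euw; have [un wn] := e_lt euw; have [j [jM sj dj]] := y_edge Y euw.
have := mk_slot jM; rewrite (c_sm C jM) (c_dm C jM) sj dj.
have [->|r2uw] := eqVneq (r2 u) (r2 w); first by constructor 1.
have [->|uw] := eqVneq u (top w); first by constructor 2.
have [->|wu] := eqVneq w (top u); first by constructor 3.
by rewrite /= !(c_mkl C) // => h; rewrite h eqxx in r2uw.
Qed.

Hypothesis share_slot : forall j, j < M -> ~~ share s (src j) (dst j).
Hypothesis count_ok : forall m, m < n + n -> s 27 m + sharing s m = s 28 (mk m).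

Lemma edge_share u w : e u w -> ~~ share s u w.
Proof. by move=> /(y_edge Y)[j [jM <- <-]]; apply: share_slot. Qed.

Lemma nb_e m m' : nb M s m m' -> e (mv m) (mv m').
Proof.
by move=> /nbP[j [jM <- <-]]; rewrite (mv_sm C) ?(mv_dm C) //; apply: (slot_e C).
Qed.

Lemma member_share m m' : m < n + n -> m' < n + n -> m' != m -> mk m' = mk m ->
  ~~ e (mv m) (mv m') -> share s (mv m) (mv m').
Proof.
move=> mn mn' mm' mkE ne.
have := sharingP C e_lt e_irr top_r2 mk_slot share_slot mn.
rewrite (count_ok mn) eqxx => /elimT/(_ isT)/(_ m' mn' mkE mm') /orP[/nb_e|//].
by rewrite (negbTE ne).
Qed.

Lemma class_share u w : u < n -> w < n -> u != w -> ~~ e u w -> r2 u = r2 w -> share s u w.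
Proof.
move=> un wn uw ne rE; rewrite -(c_mvl C un) -(c_mvl C wn).
by apply: member_share; rewrite ?(c_mvl C) ?(c_mkl C) ?rE // 1?eq_sym //; lia.
Qed.

Lemma top_share u w : u < n -> w < n -> ~~ e u w -> w = top u -> share s u w.
Proof.
move=> un wn ne wu; have rn := r2_lt C e_lt un.
have tE : top (r2 u) = w by rewrite top_r2.
(* In the class of [u], the top is represented by the member [n + r2 u]. *)
have mvE : mv (n + r2 u) = w by rewrite (c_mvr C rn).
rewrite -(c_mvl C un) -mvE.
apply: member_share; rewrite ?(c_mvl C un) ?mvE //; try lia.
by rewrite (c_mkr C rn) tE wn (c_mkl C).
Qed.

Variables (T : finType) (G : graph T) (idx : T -> nat).
Hypothesis idx_lt : forall v, v \in verts G -> idx v < n.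
Hypothesis idx_inj : {in verts G &, injective idx}.
Hypothesis idx_adj : {in verts G &, forall u v, adjacent G u v = e (idx u) (idx v)}.

Lemma sound : two_probe_block_graph G.
Proof.
pose top_rel u x := [&& u \in verts G, x \in verts G & idx u == top (idx x)].
have top_cls : {in verts G & verts G, forall x y u,
    r2 (idx x) = r2 (idx y) -> top_rel u x -> top_rel u y}.
  move=> x y xV yV u xy; rewrite /top_rel xV yV /= => /andP[-> /eqP->] /=.
  by rewrite -(top_r2 (idx_lt xV)) xy top_r2 ?idx_lt.
have top_uniq : {in verts G &, forall u u' x, top_rel u x -> top_rel u' x -> u = u'}.
  move=> u u' uV uV' x /and3P[_ _ /eqP ux] /and3P[_ _ /eqP ux'].
  by apply: idx_inj; rewrite // ux.
have top_l u x : top_rel u x -> lev (idx u) < lev (idx x).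
  by move=> /and3P[uV xV /eqP ux]; rewrite ux; apply: top_lev; rewrite -?ux ?idx_lt.
pose N (lab : pred nat) := [set v in verts G | lab (idx v)].
have indep (lab : pred nat) : (forall u v, lab u -> lab v -> share s u v) ->
  independent G (N lab).
  move=> sh; split; first by apply/subsetP => v; rewrite inE => /andP[].
  move=> u v; rewrite !inE => /andP[uV lu] /andP[vV lv]; rewrite idx_adj //.
  by apply: contraTN (sh _ _ lu lv) => /edge_share.
exists (N (lab1 s)), (N (lab2 s)), (fill (verts G) (fun v => r2 (idx v)) top_rel).
split.
- by apply: indep => u v lu lv; rewrite /share lu lv.
- by apply: indep => u v lu lv; rewrite /share lu lv orbT.
- exact: fill_block_graph top_cls top_uniq top_l.
- split=> //; apply/subsetP => ed edG.
  have /andP[_ /cards2P[x [y [xy edE]]]] := forall_inP (graphP G) ed edG.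
  have xyG : adjacent G x y by rewrite /adjacent /= -edE.
  suff : adjacent (fill (verts G) (fun v => r2 (idx v)) top_rel) x y by rewrite edE.
  rewrite adjacent_fill.
  have [xV yV _] := adjacent_verts xyG; rewrite /fill_rel /= xV yV xy /top_rel xV yV /=.
  have : e (idx x) (idx y) by rewrite -idx_adj.
  by move/edge_class => [->|->|->]; rewrite eqxx ?orbT.
move=> x y; rewrite in_setD => /andP[nxy xyF].
have : adjacent (fill (verts G) (fun v => r2 (idx v)) top_rel) x y by [].
rewrite adjacent_fill => /and4P[xV yV xy cxy].
have ne : ~~ e (idx x) (idx y) by rewrite -idx_adj.
suff : share s (idx x) (idx y).
  by rewrite !inE xV yV => /orP[/andP[-> ->]|/andP[-> ->]]; [left|right].
have ixy : idx x != idx y by apply: contra xy => /eqP/idx_inj->.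
case/or3P: cxy => [/eqP rE|/and3P[_ _ /eqP tE]|/and3P[_ _ /eqP tE]].
- by apply: class_share; rewrite ?idx_lt.
- rewrite /share andbC (andbC (lab2 _ _)) -/(share s (idx y) (idx x)).
  by apply: top_share; rewrite ?idx_lt // e_sym.
- by apply: top_share; rewrite ?idx_lt.
Qed.

End Sound.

(** * 2-probe block graphs are accepted *)

Section Complete.
Variables (n M : nat) (e : rel nat) (s : store).
Hypothesis C : results n M e s.
Hypothesis e_lt : forall u w, e u w -> u < n /\ w < n.
Hypothesis e_sym : symmetric e.
Hypothesis e_irr : irreflexive e.

Local Notation dst := (s 2).
Local Notation lev := (s 10).
Local Notation par := (s 11).
Local Notation root := (s 12).
Local Notation src := (s 13).
Local Notation mult := (s 14).
Local Notation top := (s 15).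
Local Notation r1 := (s 17).
Local Notation r2 := (s 19).
Local Notation mk := (s 21).
Local Notation mv := (s 22).
Local Notation sm := (s 24).
Local Notation dm := (s 25).
Local Notation sg := (s 29).
Local Notation db := (s 32).
Local Notation ref := (s 33).
Local Notation ar := (s 34).
Local Notation col := (s 35).

(* e' is the adjacency of a block graph G' that fills G, conn x a b says that a and
   b are connected in G' - x, and l1, l2 are the two independent sets. *)
Variables (e' : rel nat) (conn : nat -> nat -> nat -> Prop) (l1 l2 : pred nat).
Hypothesis e'_sub : forall u w, e u w -> e' u w.
Hypothesis e'_sym : symmetric e'.
Hypothesis conn_refl : forall x a, a < n -> a != x -> conn x a a.
Hypothesis conn_sym : forall x a b, conn x a b -> conn x b a.
Hypothesis conn_trans : forall x a b c, conn x a b -> conn x b c -> conn x a c.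
Hypothesis conn_edge : forall x a b, e' a b -> a != x -> b != x -> conn x a b.
Hypothesis star : forall x a b, e' x a -> e' x b -> a != b -> conn x a b -> e' a b.

Definition meet u w := (l1 u && l1 w) || (l2 u && l2 w).
Hypothesis meet_nonadj : forall u w, e' u w -> ~~ e u w -> meet u w.
Hypothesis meet_adj : forall u w, e u w -> ~~ meet u w.

Let Y := c_lay C.

(* The label of v is {1, 2}, so the one of its neighbour u is empty. *)
Lemma obstruction v a b u c : e' v a -> ~~ e v a -> e' v b -> ~~ e v b -> e a b ->
  e u v -> e' u c -> ~~ e u c -> False.
Proof.
move=> va nva vb nvb ab uv uc nuc.
have := meet_nonadj va nva; have := meet_nonadj vb nvb; have := meet_nonadj uc nuc.
have := meet_adj ab; have := meet_adj uv; rewrite /meet.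
by case: (l1 v); case: (l2 v); case: (l1 a); case: (l2 a); case: (l1 b); case: (l2 b);
   case: (l1 u); case: (l2 u).
Qed.

Lemma ne_lev a b : lev a <> lev b -> a != b.
Proof. by move=> h; apply/eqP => ab; rewrite ab in h. Qed.

(* Every disequality in the context makes lia split cases. *)
Ltac level_lia := repeat match goal with
  | H : _ <> _ |- _ => clear H
  | H : is_true (~~ _) |- _ => clear H
  | H : is_true (e _ _) |- _ => clear H
  | H : is_true (e' _ _) |- _ => clear H
  end; lia.
Ltac levels := try solve [done | rewrite eq_sym // | apply: ne_lev; level_lia | level_lia].


(** * Detours along the search tree *)

Lemma far a b : (lev b).+1 < lev a -> ~~ e a b.
Proof. by rewrite ltnNge; apply: contra; rewrite e_sym; apply: (y_lev Y). Qed.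

(** After its first vertex, the tree path from [a] stays on levels below that of [x] and therefore
    misses [x]. *)
Lemma reach x a : a < n -> a != x -> lev a <= lev x -> conn x a (root a).
Proof.
have [k] := ubnP (lev a); elim: k a => // k IHk a; rewrite ltnS => lk an ax la.
have [->|/eqP ra] := eqVneq (root a) a; first exact: conn_refl.
have [pn ep lp] := par_lt Y e_lt an ra.
have px : par a != x by levels.
rewrite (y_root Y ep); apply: (conn_trans (b := par a)).
  by apply: conn_edge => //; apply: e'_sub; rewrite e_sym.
by apply: IHk => //; lia.
Qed.

Lemma meetup x a b : a < n -> b < n -> a != x -> b != x -> lev a <= lev x ->
  lev b <= lev x ->
  root a = root b -> conn x a b.
Proof.
move=> an bn ax bx la lb rab; apply: (conn_trans (reach an ax la)).
by rewrite rab; apply/conn_sym/reach.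
Qed.

Lemma step x a b c : e' a b -> a != x -> b != x -> conn x b c -> conn x a c.
Proof. by move=> ab ax bx; apply: conn_trans; apply: conn_edge. Qed.

Lemma nonroot u x : u < n -> x < n -> u != x -> lev x <= lev u -> root u = root x ->
  root u <> u.
Proof.
move=> un xn ux lx rx ru; have [_ _ _] := root_lev Y e_lt xn.
by rewrite -rx ru => -[ux'|]; [rewrite ux' eqxx in ux | lia].
Qed.

Lemma mult0 x w : e x w -> lev w = (lev x).+1 -> mult w = 0 -> x = par w.
Proof.
move=> xw lw mw; apply/eqP/negPn/negP => /eqP xp.
have [j [jM sj dj]] := y_edge Y xw.
suff : mult w != 0 by rewrite mw.
by apply/(c_mult C); exists j; rewrite sj dj; split=> // /esym.
Qed.

Lemma multP w : mult w != 0 -> exists x, [/\ e x w, lev w = (lev x).+1 & x != par w].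
Proof.
move=> /(c_mult C)[j [jM dj lw pw]]; exists (src j); rewrite -{1}dj.
by split=> //; [apply: (y_slot Y) | apply/eqP => /esym].
Qed.

Definition up x w := e x w /\ lev w = (lev x).+1.

Lemma up_lt x w : up x w -> x < n /\ w < n.
Proof. by case=> /e_lt. Qed.

Lemma par_up w : w < n -> root w <> w -> up (par w) w.
Proof. by move=> wn rw; have [_ ? ?] := par_lt Y e_lt wn rw. Qed.

Lemma up_root x w : up x w -> root w = root x.
Proof. by case=> xw _; apply: (y_root Y). Qed.

(** From [w] one gets to the parent of [x] through [x'] and the tree without meeting [x], so [star]
    applies at [x]. *)
Lemma two_up x x' w : up x w -> up x' w -> x != x' -> root x <> x /\ e' w (par x).
Proof.
move=> xw xw' xx'; have [xn wn] := up_lt xw; have [xn' _] := up_lt xw'.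
have rx : root x = root x' by rewrite -(up_root xw) (up_root xw').
have [ew lw] := xw; have [ew' lw'] := xw'.
have nx : root x <> x by apply: (nonroot (x := x')) => //; lia.
have [et lt] := par_up xn nx; have [tn _] := e_lt et; split=> //.
have e1 : e' x w by apply: e'_sub.
have e2 : e' x (par x) by rewrite e'_sym; apply: e'_sub.
apply: (star e1 e2); first levels.
apply: (step (b := x')); [by rewrite e'_sym; apply: e'_sub|levels|levels|].
apply: meetup; levels.
by rewrite -rx (y_root Y et).
Qed.

(** If the parents [t] and [t'] differ, the detour through [t'] makes [w] and [x] adjacent in [G']
    to the parent [p] of [t]. Then [t] and [p] are adjacent nonneighbours of [w], and its neighbour
    [x] has the nonneighbour [p]. *)
Lemma two_up_par x x' w : up x w -> up x' w -> x != x' -> par x = par x'.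
Proof.
move=> xw xw' xx'; apply/eqP/negPn/negP => tt'.
have [xn wn] := up_lt xw; have [xn' _] := up_lt xw'.
have [nx wt] := two_up xw xw' xx'.
have [nx' wt'] : root x' <> x' /\ e' w (par x') by apply: (two_up xw' xw); rewrite eq_sym.
have tx := par_up xn nx; have tx' := par_up xn' nx'.
move: tt' tx tx' wt wt'; set t := par x; set t' := par x' => tt' tx tx' wt wt'.
have [tn _] := up_lt tx; have [tn' _] := up_lt tx'.
have rt : root t = root t'.
  by rewrite -(up_root tx) -(up_root tx') -(up_root xw) -(up_root xw').
have [[_ l1'] [_ l2']] := (tx, tx'); have [[_ l3'] [_ l4']] := (xw, xw').
have nt : root t <> t by apply: (nonroot (x := t')) => //; lia.
have st := par_up tn nt; move: st; set p := par t => st; have [pn _] := up_lt st.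
have [_ l5'] := st.
have pt : e' t p by rewrite e'_sym; apply: e'_sub; case: st.
have cw : conn t w p.
  apply: (step (b := x')); [by rewrite e'_sym; apply: e'_sub; case: xw'|levels|levels|].
  apply: (step (b := t')); [by rewrite e'_sym; apply: e'_sub; case: tx'|levels|levels|].
  apply: meetup; levels.
  by rewrite -rt (up_root st).
have wp : e' w p.
  by apply: (star (x := t)) => //; [rewrite e'_sym|levels].
have xp : e' x p.
  apply: (star (x := t)) => //; [by apply: e'_sub; case: tx|levels|].
  by apply: (step (b := w)) => //; [apply: e'_sub; case: xw|levels|levels].
apply: (@obstruction w t p x p) => //; try (apply: far; level_lia).
- by rewrite e_sym; case: st.
- by case: xw.
Qed.

Lemma mult_spec w : w < n -> mult w != 0 ->
  [/\ up (par w) w, root (par w) <> par w, e' w (par (par w)) &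
      forall x, up x w -> par x = par (par w)].
Proof.
move=> wn mw; have pw := par_up wn (mult_root C e_lt wn mw).
have [x [xw lx xp]] := multP mw.
have [nr ew] : root (par w) <> par w /\ e' w (par (par w)).
  by apply: (two_up pw (x' := x)) => //; rewrite eq_sym.
split=> // y yw; have [->//|yp] := eqVneq y (par w).
exact: two_up_par yw pw yp.
Qed.

(** This makes the top of [u] its parent, which is the top of [w] too. Otherwise the obstruction
    arises as in [two_up_par], one level above [t]. *)
Lemma mult_up w u : w < n -> mult w != 0 -> up u w -> mult u = 0.
Proof.
move=> wn mw uw; apply/eqP/negPn/negP => mu.
have [pw nr wt' sib] := mult_spec wn mw; have pu := sib u uw.
have [un _] := up_lt uw; have [tu nt ep sibu] := mult_spec un mu.
move: tu nt ep sibu; rewrite pu; move: wt'; set t := par (par w) => wt tu nt ep sibu.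
have [t' [t'u lt' t't]] := multP mu; have t'u' : up t' u by split.
rewrite pu -/t in t't.
have [tn _] := up_lt tu; have [tn' _] := up_lt t'u'.
have pt := par_up tn nt; move: pt ep sibu; set p := par t => pt ep sibu.
have [pn _] := up_lt pt.
have [[_ l1'] [_ l2'] [_ l3']] := And3 uw tu pt.
have e1 : e' t p by rewrite e'_sym; apply: e'_sub; case: pt.
have wp : e' w p.
  apply: (star (x := t)) => //; [by rewrite e'_sym|levels|].
  apply: (step (b := u)); [by rewrite e'_sym; apply: e'_sub; case: uw|levels|levels|].
  apply: (step (b := t')); [by rewrite e'_sym; apply: e'_sub; case: t'u'|levels|by []|].
  apply: meetup; levels.
  by rewrite -(up_root t'u') -(up_root pt) (up_root tu).
apply: (@obstruction w t p u p) => //; try (apply: far; level_lia).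
- by rewrite e_sym; case: pt.
- by case: uw.
Qed.

(** Otherwise the parent [x] of [u] is not adjacent to [w], whose only upper neighbour is [y].
    Detours make [x] and its parent [p] adjacent to [w] in [G'], and [p] to [u]: an obstruction at
    [w]. *)
Lemma horizontal_par u w : e u w -> lev u = lev w -> mult w = 0 -> par u = par w.
Proof.
move=> uw luw mw; apply/eqP/negPn/negP => xy.
have [un wn] := e_lt uw.
have uw' : u != w by apply/eqP => E; rewrite E e_irr in uw.
have ruw := y_root Y uw.
have nu : root u <> u by apply: (nonroot (x := w)) => //; lia.
have nw : root w <> w by apply: (nonroot (x := u)) => //; [rewrite eq_sym|lia].
have xu := par_up un nu; have yw := par_up wn nw.
move: xu yw xy; set x := par u; set y := par w => xu yw xy.
have [xn _] := up_lt xu; have [yn _] := up_lt yw.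
have rxy : root x = root y by rewrite -(up_root xu) -(up_root yw) ruw.
have [[exu lu] [eyw lw]] := (xu, yw).
have nx : root x <> x by apply: (nonroot (x := y)) => //; lia.
have px := par_up xn nx; move: px; set p := par x => px.
have [pn _] := up_lt px; have [epx lx] := px.
have nxw : ~~ e w x.
  apply/negP => xw; move/eqP: xy; apply; apply: mult0 => //; first by rewrite e_sym.
  lia.
have e1 : e' w x.
  apply: (star (x := u)); [exact: e'_sub|by rewrite e'_sym; apply: e'_sub|levels|].
  apply: meetup; levels.
  by rewrite ruw (up_root xu).
have e2 : e' x p by rewrite e'_sym; apply: e'_sub.
have cw : conn x w p.
  apply: (step (b := y)); [by rewrite e'_sym; apply: e'_sub|levels|levels|].
  apply: meetup; levels.
  by rewrite -rxy (up_root px).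
have e3 : e' w p.
  by apply: (star (x := x)) => //; [rewrite e'_sym|levels].
have e4 : e' u p.
  apply: (star (x := x)) => //; [exact: e'_sub|levels|].
  by apply: (step (b := w)) => //; [apply: e'_sub|levels|levels].
by apply: (@obstruction w x p u p) => //; try (apply: far; level_lia); rewrite e_sym.
Qed.

Lemma horizontal_mult u w : e u w -> lev u = lev w -> mult u != 0 -> mult w = 0 -> False.
Proof.
move=> uw luw mu mw; have [un wn] := e_lt uw.
have puw := horizontal_par uw luw mw.
have [xu nx e1 sib] := mult_spec un mu; have [x' [x'u lx' x'x]] := multP mu.
have ux' : up x' u by split.
have px' := sib x' ux'; move: xu nx e1 px' x'x puw; set x := par u => xu nx e1 px' x'x puw.
have [xn _] := up_lt xu; have [xn' _] := up_lt ux'.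
have px := par_up xn nx.
have rx : root x = root x' by rewrite -(up_root xu) -(up_root ux').
have nx' : root x' <> x' by apply: (nonroot (x := x)) => //; have [_ ?] := xu; lia.
have tx' := par_up xn' nx'; rewrite px' in tx'.
move: px e1 tx'; set t := par x => tx e1 tx'.
have [tn _] := up_lt tx.
have [[ex lx] [et lt]] := (xu, tx).
have nwx' : ~~ e w x'.
  apply/negP => wx'; move/eqP: x'x; apply; rewrite puw; apply: mult0 => //;
    first by rewrite e_sym.
  by lia.
have wx : e' x w by apply: e'_sub; rewrite puw; case: (par_up wn _) => //;
  apply: (nonroot (x := u)) => //; [by rewrite eq_sym; apply/eqP => E;
    rewrite E e_irr in uw|lia|rewrite (y_root Y uw)].
have e2 : e' w x'.
  apply: (star (x := u)); [exact: e'_sub|by rewrite e'_sym; apply: e'_sub|levels|].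
  have wu : w != u by apply/eqP => E; rewrite E e_irr in uw.
  apply: meetup; levels.
  by rewrite (y_root Y uw) (up_root ux').
have e3 : e' w t.
  apply: (star (x := x)) => //; [by rewrite e'_sym; apply: e'_sub|levels|].
  apply: (step (b := u)); [by rewrite e'_sym; apply: e'_sub|levels|levels|].
  apply: (step (b := x')); [by rewrite e'_sym; apply: e'_sub|levels|by []|].
  apply: meetup; levels.
  by rewrite -(up_root tx').
apply: (@obstruction w x' t u t) => //; try (apply: far; level_lia).
by rewrite e_sym; case: tx'.
Qed.

Lemma horizontal_top u w : e u w -> lev u = lev w -> mult u != 0 -> mult w != 0 ->
  par (par u) = par (par w).
Proof.
move=> uw luw mu mw; apply/eqP/negPn/negP => tt'; have [un wn] := e_lt uw.
have [xu nx ut sibu] := mult_spec un mu; have [yw ny wt sibw] := mult_spec wn mw.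
move: xu nx ut sibu yw ny wt sibw tt'; set x := par u;
  set y := par w => xu nx ut _ yw ny wt _.
have [xn _] := up_lt xu; have [yn _] := up_lt yw.
have tx := par_up xn nx; have ty := par_up yn ny.
move: tx ty ut wt; set t := par x; set t' := par y => tx ty ut wt tt'.
have [tn _] := up_lt tx; have [tn' _] := up_lt ty.
have [[exu lu] [eyw lw]] := (xu, yw); have [[etx lx] [ety ly]] := (tx, ty).
have rt : root t = root t'.
  by rewrite -(up_root tx) -(up_root ty) -(up_root xu) -(up_root yw) (y_root Y uw).
have nt : root t <> t by apply: (nonroot (x := t')) => //; lia.
have pt := par_up tn nt; move: pt; set p := par t => pt.
have [pn _] := up_lt pt; have [ept lt] := pt.
have e1 : e' t p by rewrite e'_sym; apply: e'_sub.
have cu : conn t u p.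
  apply: (step (b := w)); [exact: e'_sub|levels|levels|].
  apply: (step (b := y)); [by rewrite e'_sym; apply: e'_sub|levels|levels|].
  apply: (step (b := t')); [by rewrite e'_sym; apply: e'_sub|levels|levels|].
  apply: meetup; levels.
  by rewrite -rt (up_root pt).
have e2 : e' u p.
  by apply: (star (x := t)) => //; [rewrite e'_sym|levels].
have e3 : e' x p.
  apply: (star (x := t)) => //; [exact: e'_sub|levels|].
  by apply: (step (b := u)) => //; [apply: e'_sub|levels|levels].
by apply: (@obstruction u t p x p) => //; try (apply: far; level_lia); rewrite e_sym.
Qed.

(** * Tops of adjacent vertices *)

Lemma top_e' v : v < n -> top v < n -> e' v (top v).
Proof.
move=> vn; rewrite (c_top C vn); case: ifPn => mv tn; first by have [] := mult_spec vn mv.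
rewrite e'_sym; apply: e'_sub; case: (y_par Y vn) => [[pv _]|[]//].
by rewrite pv ltnn in tn.
Qed.

Lemma edge_top_leq u w : e u w -> lev u <= lev w -> top u = top w /\ top u < n \/ u = top w.
Proof.
move=> uw; rewrite leq_eqVlt; have [un wn] := e_lt uw; have luw := y_lev Y uw.
rewrite (c_top C un) (c_top C wn); case/orP => [/eqP lE|lt].
  left; have uw' : u != w by apply/eqP => E; rewrite E e_irr in uw.
  have nu : root u <> u by apply: (nonroot (x := w)) => //; [lia|rewrite (y_root Y uw)].
  have wu : e w u by rewrite e_sym.
  case: ifPn => mu; case: ifPn => mw.
  - split; first exact: horizontal_top.
    have [xu nx _ _] := mult_spec un mu; have [xn _] := up_lt xu.
    by have [] := up_lt (par_up xn nx).
  - by case: (horizontal_mult uw lE mu); apply/eqP; rewrite -[_ == _]negbK.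
  - by case: (horizontal_mult wu (esym lE) mw); apply/eqP; rewrite -[_ == _]negbK.
  - split; first by apply: horizontal_par => //; apply/eqP; rewrite -[_ == _]negbK.
    by have [] := up_lt (par_up un nu).
have uw' : up u w by split=> //; lia.
case: (boolP (mult w != 0)) => mw; last first.
  by right; apply: mult0 => //; [lia|apply/eqP; rewrite -[_ == _]negbK].
left; have [xw nx _ sib] := mult_spec wn mw; have [xn _] := up_lt xw.
rewrite (mult_up wn mw uw') /= (sib u uw'); split=> //.
by have [] := up_lt (par_up xn nx).
Qed.

Lemma edge_top u w : e u w -> [\/ top u = top w /\ top u < n, u = top w | w = top u].
Proof.
move=> uw; have [lt|lt] := leqP (lev u) (lev w).
  by case: (edge_top_leq uw lt) => ?; [constructor 1|constructor 2].
have wu : e w u by rewrite e_sym.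
case: (edge_top_leq wu (ltnW lt)) => [[tE tn]|?]; [constructor 1|by constructor 3].
by rewrite -tE.
Qed.


Lemma top_ne v : v < n -> v != top v.
Proof.
move=> vn; have [tn|tn] := ltnP (top v) n; last by rewrite neq_ltn (leq_trans vn tn).
by apply: ne_lev; have := top_lev C e_lt vn tn; lia.
Qed.

(** * Classes as balls of radius two *)

Definition se u w := e u w && (top u == top w).

Lemma se_sym u w : se u w = se w u.
Proof. by rewrite /se e_sym eq_sym. Qed.

Lemma seP u w : se u w -> [/\ e u w, top u = top w, top u < n & u < n /\ w < n].
Proof.
move=> /andP[uw /eqP tE]; have [un wn] := e_lt uw; split=> //.
case: (edge_top uw) => [[]//|uE|wE].
  by have := top_ne un; rewrite tE -uE eqxx.
by have := top_ne wn; rewrite -tE -wE eqxx.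
Qed.

Lemma se_conn u w : se u w -> conn (top u) u w.
Proof.
move=> /seP[uw tE _ [un wn]]; apply: conn_edge; first exact: e'_sub.
  exact: top_ne.
by rewrite tE top_ne.
Qed.

Lemma same_top_e' u w : u < n -> w < n -> top u < n -> top u = top w -> u != w ->
  conn (top u) u w -> e' u w.
Proof.
move=> un wn tn tE uw; apply: star => //; rewrite e'_sym; first exact: top_e'.
by rewrite tE; apply: top_e'; rewrite -?tE.
Qed.

(** All four vertices are connected in [G'] without their common top, hence pairwise adjacent in
    [G'] when distinct. In a walk without shortcuts, [b] and [y] are adjacent nonneighbours of [u],
    and its neighbour [a] has the nonneighbour [y]. *)
Lemma distance_three u a b y : se u a -> se a b -> se b y ->
  [\/ u = y, se u y | exists c, se u c /\ se c y].
Proof.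
move=> ua ab bY; have [eua tua tn [un an]] := seP ua.
have [eab tab _ [_ bn]] := seP ab; have [eby tby _ [_ yn]] := seP bY.
have [->|uy] := eqVneq u y; first by constructor 1.
have tuy : top u = top y by rewrite tua tab.
have [e_uy|neuy] := boolP (e u y); first by constructor 2; rewrite /se e_uy tuy eqxx.
have [e_ub|neub] := boolP (e u b).
  by constructor 3; exists b; split=> //; rewrite /se e_ub tua tab eqxx.
have [e_ay|neay] := boolP (e a y).
  by constructor 3; exists a; split=> //; rewrite /se e_ay tab tby eqxx.
have ub : u != b by apply: contraNneq neuy => ->.
have ay : a != y by apply: contraNneq neuy => <-.
have cub : conn (top u) u b by apply: conn_trans (se_conn ua) _; rewrite tua;
  apply: se_conn.
have cay : conn (top a) a y by apply: conn_trans (se_conn ab) _; rewrite tab;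
  apply: se_conn.
have cuy : conn (top u) u y by apply: conn_trans (se_conn ua) _; rewrite tua.
case: (@obstruction u b y a y) => //.
- by apply: same_top_e' => //; rewrite tua.
- exact: same_top_e'.
- by rewrite e_sym.
- by apply: same_top_e' => //; rewrite -tua //.
Qed.

Definition near u y := [\/ u = y, se u y | exists c, se u c /\ se c y].

Lemma near_step u w y : se u w -> near w y -> near u y.
Proof.
move=> uw [<-|wy|[c [wc cy]]]; [by constructor 2|by constructor 3; exists w|].
exact: distance_three uw wc cy.
Qed.

Lemma r1_geq v w : v < n -> se v w -> w <= r1 v.
Proof.
move=> vn /andP[/(y_edge Y)[j [jM sj dj]] /eqP tE]; have [_ h _] := c_r1 C vn.
by have := h j jM sj; rewrite sj dj; apply.
Qed.

Lemma r2_geq v w : v < n -> se v w -> r1 w <= r2 v.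
Proof.
move=> vn /andP[/(y_edge Y)[j [jM sj dj]] /eqP tE]; have [_ h _] := c_r2 C vn.
by have := h j jM sj; rewrite sj dj; apply.
Qed.

Lemma near_r2 v y : v < n -> near v y -> y <= r2 v.
Proof.
move=> vn; have [r12 _ _] := c_r2 C vn; have [vr1 _ _] := c_r1 C vn.
case=> [<-|vy|[c [vc cy]]].
- exact: leq_trans r12.
- exact: leq_trans (r1_geq vn vy) r12.
- have [_ _ _ [_ cn]] := seP vc.
  exact: leq_trans (r1_geq cn cy) (r2_geq vn vc).
Qed.

Lemma slot_se j v : j < M -> src j = v -> top (src j) = top (dst j) -> se v (dst j).
Proof. by move=> jM <- tE; rewrite /se (slot_e C) // tE eqxx. Qed.

Lemma r2_near v : v < n -> near v (r2 v).
Proof.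
move=> vn; have r1P u : u < n -> r1 u = u \/ se u (r1 u).
  move=> un; have [_ _ [->|[j [jM sj tE ->]]]] := c_r1 C un; [by left|right].
  exact: slot_se.
have [_ _ [->|[j [jM sj tE ->]]]] := c_r2 C vn.
  by case: (r1P v vn) => [->|h]; [constructor 1|constructor 2].
have vd := slot_se jM sj tE; have [_ _ _ [_ dn]] := seP vd.
by case: (r1P _ dn) => [->|h]; [constructor 2|constructor 3; exists (dst j)].
Qed.

(** By [near_step] the balls of radius 2 around [u] and [w] coincide, and so do their maxima. *)
Lemma se_r2 u w : se u w -> r2 u = r2 w.
Proof.
move=> uw; have [_ _ _ [un wn]] := seP uw; apply/eqP; rewrite eqn_leq.
rewrite (near_r2 wn (near_step _ (r2_near un))) 1?se_sym //.
by rewrite (near_r2 un (near_step uw (r2_near wn))).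
Qed.

Lemma near_top v y : near v y -> top v = top y.
Proof. by case=> [->//|/seP[]//|[c [/seP[_ -> _ _] /seP[]]]]. Qed.

Lemma top_r2 v : v < n -> top (r2 v) = top v.
Proof. by move=> vn; rewrite (near_top (r2_near vn)). Qed.

Lemma near_conn v y : v < n -> near v y -> conn (top v) v y.
Proof.
move=> vn [<-|/se_conn//|[c [vc cy]]]; first by apply: conn_refl => //; apply: top_ne.
by apply: conn_trans (se_conn vc) _; have [_ -> _ _] := seP vc; apply: se_conn.
Qed.

Lemma near_top_lt v y : near v y -> v != y -> top v < n.
Proof. by case=> [->|/seP[]//|[c [/seP[]]]//]; rewrite eqxx. Qed.

Lemma class_e' u w : u < n -> w < n -> r2 u = r2 w -> u != w ->
  [/\ top u = top w, top u < n & e' u w].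
Proof.
move=> un wn rE uw; have [nu nw] := (r2_near un, r2_near wn).
have tE : top u = top w by rewrite -(top_r2 un) rE top_r2.
have tn : top u < n.
  have [ur|ur] := eqVneq u (r2 u); last exact: near_top_lt nu ur.
  by rewrite tE; apply: near_top_lt nw _; rewrite -rE -ur eq_sym.
split=> //; apply: same_top_e' => //; apply: conn_trans (near_conn un nu) _.
by apply: conn_sym; rewrite rE tE; apply: near_conn.
Qed.

Lemma r2_top v : v < n -> top v < n -> r2 v != r2 (top v).
Proof.
move=> vn tn; apply/eqP => rE.
have [tE _ _] := class_e' vn tn rE (top_ne vn).
by have := top_ne tn; rewrite -tE eqxx.
Qed.

Lemma top_top v : v < n -> top v < n -> v != top (top v).
Proof.
move=> vn tn; have [ttn|ttn] := ltnP (top (top v)) n;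
  last by rewrite neq_ltn (leq_trans vn ttn).
by apply: ne_lev; have := top_lev C e_lt vn tn; have := top_lev C e_lt tn ttn; lia.
Qed.

Lemma mk_top v : v < n -> top v < n -> mk (n + r2 v) = r2 v.
Proof. by move=> vn tn; rewrite (c_mkr C) ?(r2_lt C) // top_r2 // tn. Qed.

(** * Members of a class and their adjacency *)

Lemma slot_members j : j < M ->
  [\/ [/\ sm j = src j, dm j = dst j & r2 (src j) = r2 (dst j)],
      [/\ sm j = n + r2 (dst j), dm j = dst j & src j = top (dst j)] |
      [/\ sm j = src j, dm j = n + r2 (src j) & dst j = top (src j)]].
Proof.
move=> jM; have ej := slot_e C jM; have [un wn] := slot_lt C e_lt jM.
rewrite (c_sm C jM) (c_dm C jM); case: (edge_top ej) => [[tE tn]|uE|wE].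
- by constructor 1; rewrite (se_r2 (u := src j) (w := dst j)) ?eqxx //; apply: slot_se.
- have tn : top (dst j) < n by rewrite -uE.
  have h1 : r2 (src j) != r2 (dst j) by rewrite uE eq_sym r2_top.
  have h2 : (dst j == top (src j)) = false by rewrite uE; apply/negbTE/top_top.
  by constructor 2; rewrite h1 h2 -uE eqxx.
- have tn : top (src j) < n by rewrite -wE.
  have h1 : r2 (src j) != r2 (dst j) by rewrite wE r2_top.
  have h2 : (src j == top (dst j)) = false by rewrite wE; apply/negbTE/top_top.
  by constructor 3; rewrite h1 h2 -wE eqxx.
Qed.

Lemma mk_slot j : j < M -> mk (sm j) = mk (dm j).
Proof.
move=> jM; have [un wn] := slot_lt C e_lt jM.
case: (slot_members jM) => [[-> -> rE]|[-> -> uE]|[-> -> wE]].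
- by rewrite !(c_mkl C).
- by rewrite mk_top // -?uE // (c_mkl C).
- by rewrite mk_top // -?wE // (c_mkl C).
Qed.

Lemma nb_sym m m' : nb M s m m' = nb M s m' m.
Proof.
suff h a b : nb M s a b -> nb M s b a by apply/idP/idP; apply: h.
case/nbP=> j [jM <- <-]; have ej := slot_e C jM; rewrite e_sym in ej.
have [j' [jM' sj dj]] := y_edge Y ej; apply/nbP; exists j'; split=> //.
  by rewrite (c_sm C jM') (c_dm C jM) sj dj eq_sym.
by rewrite (c_sm C jM) (c_dm C jM') sj dj eq_sym.
Qed.

Lemma member_own_top u m : u < n -> mk (n + m) = r2 u -> m < n ->
  [/\ m = r2 u, top u < n & mv (n + m) = top u].
Proof.
move=> un mkE mn; move: mkE; have := r2_lt C e_lt un; rewrite (c_mkr C) //.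
rewrite (c_mvr C) //; case: ifP => [tn rn mE|_ rn mE]; last by lia.
by rewrite mE top_r2 // -{1}(top_r2 un) -mE.
Qed.

Lemma memberP m : m < n + n -> m < n \/ exists2 i, i < n & m = n + i.
Proof.
move=> mn; have [?|nm] := ltnP m n; [by left|right].
by exists (m - n); [lia|rewrite subnKC].
Qed.

Lemma nb_mv m m' : nb M s m m' -> e (mv m) (mv m').
Proof.
case/nbP=> j [jM <- <-]; rewrite (mv_sm C e_lt top_r2) // (mv_dm C e_lt top_r2) //.
exact: (slot_e C).
Qed.

(** A class has at most one member of the form [n + i], so at least one of the two is a vertex in
    its own class, and the other is such a vertex or the copy of its top. *)
Lemma same_class m m' : m < n + n -> m' < n + n -> m != m' -> mk m = mk m' ->
  e' (mv m) (mv m') /\ nb M s m m' = e (mv m) (mv m').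
Proof.
have own_top u i : u < n -> i < n -> mk (n + i) = r2 u ->
    e' u (mv (n + i)) /\ nb M s u (n + i) = e u (mv (n + i)).
  move=> un iN mkE; have [iE tn mvE] := member_own_top un mkE iN.
  rewrite mvE; split; first exact: top_e'.
  apply/idP/idP => [/nb_mv|eu]; first by rewrite mvE (c_mvl C un).
  have [j [jM sj dj]] := y_edge Y eu; apply/nbP; exists j; split=> //.
    by rewrite (c_sm C jM) sj dj (negbTE (top_top un tn)) andbF.
  by rewrite (c_dm C jM) sj dj eqxx r2_top // iE.
move=> /memberP[un|[i iN ->]] /memberP[wn|[i' iN' ->]] mm' mkE.
- rewrite !(c_mkl C) // in mkE; have [tE tn ee] := class_e' un wn mkE mm'.
  rewrite !(c_mvl C) //; split=> //; apply/idP/idP => [/nb_mv|eu].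
    by rewrite !(c_mvl C).
  have [j [jM sj dj]] := y_edge Y eu; apply/nbP; exists j; split=> //.
    by rewrite (c_sm C jM) sj dj mkE eqxx.
  by rewrite (c_dm C jM) sj dj mkE eqxx.
- by rewrite (c_mvl C un); apply: own_top; rewrite // -mkE (c_mkl C).
- by rewrite (c_mvl C wn) nb_sym e_sym e'_sym; apply: own_top; rewrite // mkE (c_mkl C).
- move: mkE mm'; rewrite !(c_mkr C) //.
  by case: ifP => ?; case: ifP => ?; rewrite ?eqn_add2l; lia.
Qed.

Lemma nb_meet m m' : m < n + n -> m' < n + n -> m != m' -> mk m = mk m' ->
  nb M s m m' = ~~ meet (mv m) (mv m').
Proof.
move=> mn mn' mm' mkE; have [ee ->] := same_class mn mn' mm' mkE.
by apply/idP/idP => [/meet_adj//|]; apply: contraNT; apply: meet_nonadj.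
Qed.

(** * Forced labels and colours *)

Definition labelled v := l1 v || l2 v.
Definition full v := l1 v && l2 v.

Lemma meet_labelled u w : meet u w -> labelled u.
Proof. by rewrite /meet /labelled => /orP[/andP[->]|/andP[-> _]]; rewrite ?orbT. Qed.

Lemma full_meet u w : full u -> labelled w -> meet u w.
Proof. by rewrite /full /labelled /meet => /andP[-> ->]. Qed.

Lemma meet_sym u w : meet u w = meet w u.
Proof. by rewrite /meet andbC (andbC (l2 u)). Qed.

Let nonunivE m (mn : m < n + n) := nonunivP C e_lt e_irr top_r2 mk_slot mn.

Lemma nonuniv_labelled m : m < n + n -> nonuniv s m -> labelled (mv m).
Proof.
move=> mn /(nonunivE mn)[m' [mn' mkE mm' nm]]; apply: (@meet_labelled _ (mv m')).
by move: nm; rewrite nb_meet 1?eq_sym // negbK.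
Qed.

Lemma not_nb_nonuniv m m' : m < n + n -> m' < n + n -> m != m' -> mk m = mk m' ->
  ~~ nb M s m m' -> nonuniv s m.
Proof. by move=> mn mn' mm' mkE nm; apply/(nonunivE mn); exists m'; rewrite eq_sym. Qed.

Lemma sg_labelled v : sg v != 0 -> labelled v.
Proof. by move=> /(c_sg C)[m [mn um <-]]; apply: nonuniv_labelled. Qed.

Lemma db_sg v : db v != 0 -> sg v != 0.
Proof. by move=> /(c_db C)[m [mn um _ _ mv]]; apply/(c_sg C); exists m. Qed.

(** The member [m] is nonadjacent to both ends of an edge between members that need labels. These
    ends have disjoint labels, and the label of [m] meets both. *)
Lemma db_full v : db v != 0 -> full v.
Proof.
move=> /(c_db C)[m [mn um hm /(c_any C)[j [jM us ud mkE]] <-]].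
have [sn dn] := (sm_lt C e_lt jM, dm_lt C e_lt jM).
have nj : nb M s (sm j) (dm j) by apply/nbP; exists j.
have no_nb x : x < n + n -> nonuniv s x -> nb M s m x -> False.
  move=> xn ux /nbP[j' [jM' sj dj]].
  suff : s 30 m != 0 by rewrite hm.
  by apply/(c_has C); exists j'; rewrite sj dj.
have ne x y : x < n + n -> y < n + n -> nonuniv s y -> nb M s x y -> m != x.
  by move=> xn yn uy xy; apply/eqP => E; apply: (no_nb y); rewrite // E.
have meet_m x : x < n + n -> nonuniv s x -> m != x -> mk x = mk m -> meet (mv m) (mv x).
  move=> xn ux mx mkx; apply/negPn/negP; rewrite -nb_meet // => /no_nb; exact.
have nds : nb M s (dm j) (sm j) by rewrite nb_sym.
have m1 := meet_m _ sn us (ne _ _ sn dn ud nj) mkE.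
have mkE' : mk (dm j) = mk m by rewrite -mk_slot.
have m2 := meet_m _ dn ud (ne _ _ dn sn us nds) mkE'.
have sd : sm j != dm j by apply/eqP => E; move: nj; rewrite E (nb_irr C e_lt e_irr top_r2).
move: nj; rewrite (nb_meet sn dn sd (mk_slot jM)); move: m1 m2; rewrite /meet /full.
by case: (l1 (mv m)); case: (l2 (mv m)); case: (l1 _); case: (l2 _); case: (l1 _);
  case: (l2 _).
Qed.

(** A partial converse of [db_full]: a full vertex meets every labelled one, so no neighbour of [m]
    in the class needs a label, and the edge [a b] provides the other condition. *)
Lemma full_db m a b : m < n + n -> a < n + n -> b < n + n ->
  m != a -> mk a = mk m -> mk b = mk m -> full (mv m) -> ~~ nb M s m a -> ~~ nb M s m b ->
  m != b -> nb M s a b -> db (mv m) != 0.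
Proof.
move=> mn an bn ma mka mkb fm nma nmb mb ab; apply/(c_db C); exists m.
have ua : nonuniv s a by apply: (not_nb_nonuniv (m' := m)); rewrite // 1?eq_sym // nb_sym.
have ub : nonuniv s b by apply: (not_nb_nonuniv (m' := m)); rewrite // 1?eq_sym // nb_sym.
split=> //.
- exact: (not_nb_nonuniv (m' := a)).
- apply/eqP/negPn/negP => /(c_has C)[j [jM us ud sj]].
  have nj : nb M s m (dm j) by apply/nbP; exists j.
  have dn := dm_lt C e_lt jM.
  have md : m != dm j by apply/eqP => E; move: nj; rewrite -E (nb_irr C e_lt e_irr top_r2).
  move: nj; rewrite nb_meet //; last by rewrite -sj mk_slot.
  by rewrite full_meet //; apply: nonuniv_labelled.
- by case/nbP: ab => j [jM sj dj]; apply/(c_any C); exists j; rewrite sj dj.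
Qed.

(** If none of the three is full, each has exactly one label, and adjacency means different labels.
    A full one is adjacent to neither of the others, and these are nonadjacent by [full_db]. So
    adjacency to [m0] is a 2-colouring that decides adjacency. *)
Lemma three_members m0 m m' : m0 < n + n -> m < n + n -> m' < n + n ->
  mk m = mk m0 -> mk m' = mk m0 -> m != m' ->
  single s (mv m0) -> single s (mv m) -> single s (mv m') ->
  (nb M s m0 m == nb M s m0 m') = ~~ nb M s m m'.
Proof.
move=> n0 mn mn' mk1 mk2 mm' /andP[sg0 db0] /andP[sg1 db1] /andP[sg2 db2].
have irr x : nb M s x x = false by apply: (nb_irr C e_lt e_irr top_r2).
have [<-|m01] := eqVneq m0 m; first by rewrite irr eq_sym eqbF_neg.
have [<-|m02] := eqVneq m0 m'; first by rewrite irr eqbF_neg nb_sym.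
have [L0 [L1 L2]] := (sg_labelled sg0, (sg_labelled sg1, sg_labelled sg2)).
have mk12 : mk m = mk m' by rewrite mk1.
have nbE x y : x < n + n -> y < n + n -> x != y -> mk x = mk y ->
    nb M s x y = ~~ meet (mv x) (mv y) by exact: nb_meet.
have no_full x a b : x < n + n -> a < n + n -> b < n + n -> x != a -> x != b ->
    mk a = mk x -> mk b = mk x -> labelled (mv a) -> labelled (mv b) -> db (mv x) == 0 ->
    full (mv x) -> nb M s a b = false.
  move=> xn an bn xa xb mka mkb La Lb dx fx; apply/negP => ab.
  suff : db (mv x) != 0 by rewrite dx.
  by apply: (full_db (a := a) (b := b)) => //; rewrite nbE // negbK full_meet.
have [f0|f0] := boolP (full (mv m0)).
  rewrite (no_full m0 m m') // (nbE m0 m) // (nbE m0 m') //.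
  by rewrite !(full_meet f0).
have [f1|f1] := boolP (full (mv m)).
  have d1 : m != m0 by rewrite eq_sym.
  rewrite (no_full m m0 m') // -?mk12 //.
  by rewrite (nbE m0 m) // (nbE m m') // meet_sym !(full_meet f1).
have [f2|f2] := boolP (full (mv m')).
  have [d1 d2] : m' != m0 /\ m' != m by rewrite !(eq_sym m').
  rewrite (no_full m' m0 m) //.
  by rewrite (nbE m0 m') // (nbE m m') // meet_sym (meet_sym (mv m)) !(full_meet f2).
rewrite !nbE //; move: f0 f1 f2 L0 L1 L2; rewrite /full /labelled /meet.
by case: (l1 _); case: (l2 _); case: (l1 _); case: (l2 _); case: (l1 _); case: (l2 _).
Qed.

(** In a class, the colour is adjacency to the reference member, exchanged according to the colour
    of the top. The colour of the top itself comes from another class, but it obeys the same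
    formula: the reference is the largest suitable member, hence the copy of the top if that is
    suitable, and it is not its own neighbour. *)
Lemma col_nb m m' : m < n + n -> m' < n + n -> m != m' -> mk m = mk m' ->
  single s (mv m) -> single s (mv m') -> (col (mv m) == col (mv m')) = ~~ nb M s m m'.
Proof.
move=> mn mn' mm' mkE s1 s2.
have kn : mk m < n.
  case: (memberP mn) (memberP mn') => [un|[i iN mE]] [wn|[i' iN' mE']].
  - by rewrite (c_mkl C) // (r2_lt C e_lt).
  - by rewrite (c_mkl C) // (r2_lt C e_lt).
  - by rewrite mkE (c_mkl C) // (r2_lt C e_lt).
  - move: mkE mm'; rewrite mE mE' !(c_mkr C) //.
    by case: ifP => ?; case: ifP => ?; rewrite ?eqn_add2l; lia.
have [[_ none]|[m0 [n0 refE mk0 s0 max0]]] := c_ref C (mk m).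
  by have := none m mn erefl; rewrite s1.
have arE x : x < n + n -> mk x = mk m -> ar x = nb M s m0 x.
  move=> xn mkx; have := c_ar1 C x; have := c_ar C x.
  have [h|h] := boolP (nb M s m0 x).
    case/nbP: h => j [jM sj dj] [_ h]; have : ar x != 0 by apply: h; exists j;
      rewrite sj mk0.
    by lia.
  case=> hx _ ax; suff : ~~ (ar x != 0) by lia.
  apply/negP => /hx[j [jM rj dj]]; move/negP: h; apply; apply/nbP; exists j; split=> //.
  by move: rj; rewrite mk_slot // dj mkx refE => -[].
have colE x : x < n + n -> mk x = mk m -> single s (mv x) ->
    col (mv x) = (nb M s m0 x != col (top (mk m)) :> nat) :> nat.
  move=> xn mkx sx; case: (memberP xn) => [un|[i iN xE]].
    rewrite (c_mvl C un) (c_col C un) arE //; congr (nat_of_bool (~~ (_ == col _))).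
    by rewrite -mkx (c_mkl C un) top_r2.
  move: (mkx); rewrite xE (c_mkr C iN); case: ifP => [tn iE|_ iE]; last by lia.
  rewrite -xE (_ : nb M s m0 x = false).
    by rewrite xE (c_mvr C iN) iE; have := c_col1 C (top (mk m)); case: (col _) => [|[]].
  (* Here [x] is the copy of the top, whose number [n + i] exceeds those of all other members of the
     class. *)
  suff -> : m0 = x by apply: (nb_irr C e_lt e_irr top_r2).
  apply/eqP; rewrite eqn_leq (max0 x) // andbT.
  case: (memberP n0) => [|[i0 iN0 m0E]]; first lia.
  by move: mk0; rewrite m0E (c_mkr C iN0); case: ifP => _; lia.
rewrite !colE //= -(three_members n0 mn mn') ?mk0 //.
by case: (nb M s m0 m); case: (nb M s m0 m') => /=;
  case: (col (top (mk m))) (c_col1 C (top (mk m))) => [|[]].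
Qed.

Lemma share_slot j : j < M -> ~~ share s (src j) (dst j).
Proof.
move=> jM; apply/negP => sh; have ej := slot_e C jM; have nm := meet_adj ej.
have [sn dn] := (sm_lt C e_lt jM, dm_lt C e_lt jM).
have nj : nb M s (sm j) (dm j) by apply/nbP; exists j.
have sd : sm j != dm j by apply/eqP => E; move: nj; rewrite E (nb_irr C e_lt e_irr top_r2).
have := col_nb sn dn sd (mk_slot jM);
  rewrite nj (mv_sm C e_lt top_r2) // (mv_dm C e_lt top_r2) //.
have lab v w : share s v w -> sg v != 0.
  by rewrite /share /lab1 /lab2 => /orP[/andP[]|/andP[]] /orP[/db_sg|/andP[]].
have shs : share s (dst j) (src j) by move: sh; rewrite /share andbC (andbC (lab2 _ _)).
have [gs gd] := (lab _ _ sh, lab _ _ shs).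
have db0 v w : ~~ meet v w -> sg w != 0 -> db v == 0.
  move=> nvw gw; apply/negPn/negP => /db_full fv; move/negP: nvw; apply.
  by apply: full_meet fv (sg_labelled gw).
have ds := db0 _ _ nm gd; have dd : db (dst j) == 0 by apply: db0 gs; rewrite meet_sym;
  exact: nm.
rewrite /single gs gd ds dd => /(_ isT isT).
move: sh; rewrite /share /lab1 /lab2 gs gd ds dd /=.
have := c_col1 C (src j); have := c_col1 C (dst j); lia.
Qed.

Lemma count_ok m : m < n + n -> s 27 m + sharing s m = s 28 (mk m).
Proof.
move=> mn; apply/eqP/(sharingP C e_lt e_irr top_r2 mk_slot share_slot mn) => m' mn' mkE mm'.
have [//|nm] := boolP (nb M s m m').
have g v x : x < n + n -> nonuniv s x -> mv x = v -> sg v != 0.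
  by move=> xn ux xv; apply/(c_sg C); exists x.
have mm : m != m' by rewrite eq_sym.
have gm : sg (mv m) != 0 by apply: g (not_nb_nonuniv mn mn' mm _ nm) _.
have gm' : sg (mv m') != 0.
  by apply: g (not_nb_nonuniv mn' mn mm' mkE _) _; rewrite // nb_sym.
have := col_nb mn mn' mm (esym mkE); rewrite nm /single gm gm' /share /lab1 /lab2 gm gm' /=.
case: (db (mv m) == 0); case: (db (mv m') == 0) => //=; rewrite ?andbT ?orbT //=.
- by move=> /(_ isT isT)/eqP->; rewrite !andbb orbN.
- by case: (col (mv m) == 0).
- by case: (col (mv m') == 0).
Qed.

End Complete.

(** * Correctness of the loops *)

Lemma den_if b p q s a j :
  den (If b p q) s a j = if beval s b then den p s a j else den q s a j.
Proof. by rewrite /=; case: ifP. Qed.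

Lemma den_set X i v s j :
  den (Assign X i v) s X j = if j == eval s i then eval s v else s X j.
Proof. by rewrite /= /update eqxx. Qed.

Lemma den_when b X i v s j :
  den (when b (Assign X i v)) s X j = if beval s b &&
    (j == eval s i) then eval s v else s X j.
Proof. by rewrite den_if den_set; case: (beval s b). Qed.

Lemma prog_den_cons l ls s : prog_den (l :: ls) s = prog_den ls (for_den l.2 (eval s
  l.1) s).
Proof. by []. Qed.

Section Results.
Variables (n M : nat) (e : rel nat) (s0 : store).
Hypothesis s0n : s0 0 0 = n.
Hypothesis s0M : s0 1 n = M.
Hypothesis s0z : forall a j, 2 < a -> s0 a j = 0.
Hypothesis LS : lists n (s0 1) (s0 2) e.

Variable final : store.
Hypothesis finalE : final = prog_den loops s0.

Lemma final_input a j : a \in [:: 0; 1; 2] -> final a j = s0 a j.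
Proof. by rewrite !inE => /or3P[] /eqP->; rewrite finalE prog_den_frame. Qed.

Lemma final_layering :
  layering n (final 2) e M (final 8) (final 10) (final 11) (final 12) (final 13).
Proof.
pose s1 := for_den bfs_code (M + (n + n)) s0.
have F a : a \in [:: 8; 10; 11; 12; 13] -> s1 a =1 final a.
  move=> ha j; pose b := (nth (ELit 0, Skip) loops 0).1.
  have bE : eval s0 b = M + (n + n) by rewrite /= s0n s0M.
  rewrite finalE (_ : loops = (b, bfs_code) :: behead loops) // prog_den_cons bE -/s1.
  rewrite prog_den_frame //.
    by apply: contraTneq ha => ->.
  by move: ha; rewrite !inE => /or4P[|||/orP[]] /eqP->.
have D j : s0 2 j = final 2 j by rewrite final_input.
apply: (layering_agree (F 8 erefl) D (F 10 erefl) (F 11 erefl) (F 12 erefl) (F 13 erefl)).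
rewrite -s0M; apply: (bfs_layering LS (head := s1 4 0)).
by rewrite s0M mul2n -addnn; apply: bfs_invariant.
Qed.

Lemma loop_sequence k X : k < size loops -> 3 < X ->
    X \notin prog_writes (take k loops) -> X \notin prog_writes (drop k.+1 loops) ->
    all (pred1 X) (writes (nth (ELit 0, Skip) loops k).2) ->
    all (fun a => (a == X) || (a == 3) || (a \notin prog_writes (drop k.+1 loops)))
      (reads (nth (ELit 0, Skip) loops k).2) ->
  exists x : nat -> nat -> nat,
    [/\ forall j, x 0 j = 0,
        forall t, t < eval s0 (nth (ELit 0, Skip) loops k).1 -> forall j,
          x t.+1 j = den (nth (ELit 0, Skip) loops k).2 (replace (update final 3 0 t) X
            (x t)) X j &
        x (eval s0 (nth (ELit 0, Skip) loops k).1) =1 final X].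
Proof.
move=> kl X3 h1 h2 h3 h4.
rewrite finalE; have [||x [x0 xS xL]] := loop_final kl loops_wf _ h1 h2 h3 h4 (fun j =>
  s0z j _); try lia.
by exists x; split=> // t tL j; apply: xS.
Qed.

(** The side conditions speak of the closed term [loops] and hold by computation. *)
Ltac loop k X :=
  have := @loop_sequence k X erefl erefl erefl erefl erefl erefl;
  rewrite [nth _ _ _]/= [eval _ _]/= ?s0n ?s0M.

Ltac body := rewrite ?den_when ?den_if ?den_set /= /replace /update /=.

Local Notation dst := (final 2).
Local Notation lev := (final 10).
Local Notation par := (final 11).
Local Notation src := (final 13).
Local Notation mult := (final 14).
Local Notation top := (final 15).
Local Notation r1 := (final 17).
Local Notation r2 := (final 19).
Local Notation mk := (final 21).
Local Notation mv := (final 22).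
Local Notation sm := (final 24).
Local Notation dm := (final 25).

Let Y := final_layering.
Let fn : final 0 0 = n. Proof. by rewrite final_input. Qed.

Lemma slot_bounds j : j < M -> src j < n /\ dst j < n.
Proof. by move=> /(y_slot Y)/(l_lt LS). Qed.

Lemma mult_loop w : mult w != 0 <->
  exists j, [/\ j < M, dst j = w, lev w = (lev (src j)).+1 & par w <> src j].
Proof.
loop 1 14 => -[x [x0 xS xL]].
have := seq_mark (L := M) x0 (c := fun t =>
  (lev (dst t) == lev (src t) + 1) && (par (dst t) != src t)) (f := dst).
move=> /(_ _ w)[t tM j|_]; first by rewrite xS //; body.
rewrite xL => ->; split=> [[j [jM /andP[/eqP lE /eqP pE] dE]]|[j [jM dE lE pE]]]; exists j.
  by rewrite -dE lE addn1.
by rewrite dE lE addn1 eqxx; split=> //; apply/eqP.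
Qed.

Lemma top_loop v : v < n -> top v = if mult v != 0 then par (par v) else par v.
Proof.
move=> vn; loop 2 15 => -[x [x0 xS xL]]; rewrite -xL.
apply: (seq_map (f := fun v => if mult v != 0 then par (par v) else par v)) => // t tn j.
by rewrite xS //; body; case: ifP.
Qed.

Lemma r1_loop v : v < n -> [/\ v <= r1 v,
  forall j, j < M -> src j = v -> top (src j) = top (dst j) -> dst j <= r1 v &
  r1 v = v \/ exists j, [/\ j < M, src j = v, top (src j) = top (dst j) & r1 v = dst j]].
Proof.
move=> vn.
have -> : r1 v = if final 16 v < v + 1 then v else final 16 v - 1.
  loop 4 17 => -[x [x0 xS xL]]; rewrite -xL.
  apply: (seq_map (f := fun v => if final 16 v < v + 1 then v else final 16 v - 1)) =>
    // t tn j.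
  by rewrite xS //; body; case: ifP.
loop 3 16 => -[x [x0 xS xL]].
have [|upper att] := seq_max (L := M) x0 (c := fun t =>
  top (src t) == top (dst t)) (f := src) (v := dst) _ v.
  by move=> t tM j; rewrite xS //; body.
rewrite xL in upper att; split; first by case: ifP; lia.
  by move=> j jM sj /eqP tj; have := upper j jM tj sj; case: ifP; lia.
case: ifP => [|h]; [by left|right]; case: att => [E|[j [jM /eqP tj sj E]]];
  first by rewrite E in h; lia.
by exists j; rewrite E subn1.
Qed.

Lemma r2_loop v : v < n -> [/\ r1 v <= r2 v,
  forall j, j < M -> src j = v -> top (src j) = top (dst j) -> r1 (dst j) <= r2 v &
  r2 v = r1 v \/ exists j, [/\ j < M, src j = v, top (src j) = top (dst j) & r2 v = r1
    (dst j)]].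
Proof.
move=> vn.
have -> : r2 v = if final 18 v < r1 v + 1 then r1 v else final 18 v - 1.
  loop 6 19 => -[x [x0 xS xL]]; rewrite -xL.
  apply: (seq_map (f := fun v =>
    if final 18 v < r1 v + 1 then r1 v else final 18 v - 1)) => // t tn j.
  by rewrite xS //; body; case: ifP.
loop 5 18 => -[x [x0 xS xL]].
have [|upper att] := seq_max (L := M) x0 (c := fun t =>
  top (src t) == top (dst t)) (f := src) (v := fun t => r1 (dst t)) _ v.
  by move=> t tM j; rewrite xS //; body.
rewrite xL in upper att; split; first by case: ifP; lia.
  by move=> j jM sj /eqP tj; have := upper j jM tj sj; case: ifP; lia.
case: ifP => [|h]; [by left|right]; case: att => [E|[j [jM /eqP tj sj E]]];
  first by rewrite E in h; lia.
by exists j; rewrite E subn1.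
Qed.

Lemma r2_bound v : v < n -> r2 v < n.
Proof.
have r1n u : u < n -> r1 u < n.
  move=> un; have [_ _ [->//|[j [jM _ _ ->]]]] := r1_loop un.
  by have [] := slot_bounds jM.
move=> vn; have [_ _ [->|[j [jM _ _ ->]]]] := r2_loop vn; first exact: r1n.
by apply: r1n; have [] := slot_bounds jM.
Qed.

Lemma mk_loop m : m < n + n ->
  mk m = if m < n then r2 m else if top (m - n) < n then m - n else m.
Proof.
move=> mn; loop 8 21 => -[x [x0 xS xL]]; rewrite -xL.
apply: (seq_map (f := fun m =>
  if m < n then r2 m else if top (m - n) < n then m - n else m)) => // t tn j.
by rewrite xS //; body; rewrite fn; case: ifP => // _; case: ifP.
Qed.

Lemma mv_loop m : m < n + n -> mv m = if m < n then m else top (m - n).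
Proof.
move=> mn; loop 9 22 => -[x [x0 xS xL]]; rewrite -xL.
apply: (seq_map (f := fun m => if m < n then m else top (m - n))) => // t tn j.
by rewrite xS //; body; rewrite fn; case: ifP.
Qed.

Lemma np_loop k : k < n -> final 23 k = n + k.
Proof.
move=> kn; loop 10 23 => -[x [x0 xS xL]]; rewrite -xL.
have h := @seq_inj (n + n) x (fun t => n <= t) (fun t => t - n) id.
have -> : k = n + k - n by lia.
rewrite h; try lia.
by move=> t tn j; rewrite xS //; body; rewrite fn; case: ltnP.
Qed.

Lemma sm_loop j : j < M -> sm j = if (r2 (src j) != r2 (dst j)) && (src j == top (dst j))
  then n + r2 (dst j) else src j.
Proof.
move=> jM; have [_ dn] := slot_bounds jM; rewrite -(np_loop (r2_bound dn));
  loop 11 24 => -[x [x0 xS xL]]; rewrite -xL.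
apply: (seq_map (f := fun j => if (r2 (src j) != r2 (dst j)) && (src j == top (dst j))
  then final 23 (r2 (dst j)) else src j)) => // t tn k.
by rewrite xS //; body; case: ifP.
Qed.

Lemma dm_loop j : j < M -> dm j = if (r2 (src j) != r2 (dst j)) && (dst j == top (src j))
  then n + r2 (src j) else dst j.
Proof.
move=> jM; have [sn _] := slot_bounds jM; rewrite -(np_loop (r2_bound sn));
  loop 12 25 => -[x [x0 xS xL]]; rewrite -xL.
apply: (seq_map (f := fun j => if (r2 (src j) != r2 (dst j)) && (dst j == top (src j))
  then final 23 (r2 (src j)) else dst j)) => // t tn k.
by rewrite xS //; body; case: ifP.
Qed.

Lemma deg_loop m : final 27 m = count (fun j => sm j == m) (iota 0 M).
Proof.
loop 14 27 => -[x [x0 xS xL]]; rewrite -xL; apply: (seq_count x0 (c := xpredT)) => t tM j.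
by rewrite xS //; body; case: eqP => // ->.
Qed.

Lemma sz_loop k : final 28 k = count (fun m => mk m == k) (iota 0 (n + n)).
Proof.
loop 15 28 => -[x [x0 xS xL]]; rewrite -xL; apply: (seq_count x0 (c := xpredT)) => t tM j.
by rewrite xS //; body; case: eqP => // ->.
Qed.

Lemma sg_loop v : final 29 v != 0 <-> exists m, [/\ m < n + n, nonuniv final m & mv m = v].
Proof.
loop 16 29 => -[x [x0 xS xL]]; rewrite -xL.
have := seq_mark (L := n + n) x0 (c := nonuniv final) (f := mv).
by move=> /(_ _ v)[t tM j|//]; rewrite xS //; body; rewrite addn1.
Qed.

Lemma has_loop m : final 30 m != 0 <->
  exists j, [/\ j < M, nonuniv final (sm j), nonuniv final (dm j) & sm j = m].
Proof.
loop 17 30 => -[x [x0 xS xL]]; rewrite -xL.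
have := seq_mark (L := M) x0 (c := fun t =>
  nonuniv final (sm t) && nonuniv final (dm t)) (f := sm).
move=> /(_ _ m)[t tM j|_ ->]; first by rewrite xS //; body; rewrite !addn1.
by split=> [[t [? /andP[? ?] ?]]|[t [? ? ? ?]]]; exists t; split=> //; apply/andP.
Qed.

Lemma any_loop k : final 31 k != 0 <->
  exists j, [/\ j < M, nonuniv final (sm j), nonuniv final (dm j) & mk (sm j) = k].
Proof.
loop 18 31 => -[x [x0 xS xL]]; rewrite -xL.
have := seq_mark (L := M) x0 (c := fun t =>
  nonuniv final (sm t) && nonuniv final (dm t)) (f := fun t => mk (sm t)).
move=> /(_ _ k)[t tM j|_ ->]; first by rewrite xS //; body; rewrite !addn1.
by split=> [[t [? /andP[? ?] ?]]|[t [? ? ? ?]]]; exists t; split=> //; apply/andP.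
Qed.

Lemma db_loop v : final 32 v != 0 <->
  exists m, [/\ m < n + n, nonuniv final m, final 30 m = 0, final 31 (mk m) != 0 & mv m
    = v].
Proof.
loop 19 32 => -[x [x0 xS xL]]; rewrite -xL.
have := seq_mark (L := n + n) x0 (c := fun t =>
  nonuniv final t && ((final 30 t == 0) && (final 31 (mk t) != 0))) (f := mv).
move=> /(_ _ v)[t tM j|_ ->]; first by rewrite xS //; body; rewrite !addn1.
by split=> [[t [? /and3P[? /eqP ? ?] ?]]|[t [? ? ? ? ?]]]; exists t; split=> //;
  apply/and3P; split=> //; apply/eqP.
Qed.

Lemma ref_loop k : (final 33 k = 0 /\ forall m, m < n + n -> mk m = k ->
  ~~ single final (mv m)) \/
  (exists m0, [/\ m0 < n + n, final 33 k = m0.+1, mk m0 = k, single final (mv m0) &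
    forall m, m < n + n -> mk m = k -> single final (mv m) -> m <= m0]).
Proof.
loop 20 33 => -[x [x0 xS xL]]; rewrite -xL.
have := seq_last (L := n + n) x0 (c := fun t => single final (mv t)) (f := mk).
by apply=> t tM j; rewrite xS //; body.
Qed.

Lemma ar_loop m : final 34 m <= 1 /\ (final 34 m != 0 <->
  exists j, [/\ j < M, final 33 (mk (sm j)) = (sm j).+1 & dm j = m]).
Proof.
loop 21 34 => -[x [x0 xS xL]]; rewrite -xL.
have := seq_mark (L := M) x0 (c := fun t => final 33 (mk (sm t)) == (sm t).+1) (f := dm).
move=> /(_ _ m)[t tM j|le1 ->]; first by rewrite xS //; body; rewrite !addn1.
by split=> //; split=> [[t [? /eqP ? ?]]|[t [? ? ?]]]; exists t; split=> //; apply/eqP.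
Qed.

(** The loop uses colours while it computes them. The queue contains each vertex once and after its
    parent, hence after its top, so the colour of the top is final when it is read. *)
Lemma col_loop : (forall v, v < n -> final 35 v = ~~ (final 34 v == final 35 (top v))) /\
  forall v, final 35 v <= 1.
Proof.
loop 22 35 => -[x [x0 xS xL]].
have step t : t < n -> forall j, x t.+1 j =
    if j == final 8 t then ~~ (final 34 (final 8 t) == x t (top (final 8 t))) : nat
      else x t j.
  move=> tn j; rewrite xS //; body; case: (final 34 _ == _); by case: eqP.
have keep l t j : t <= l -> l <= n -> (forall t', t <= t' -> t' < l ->
  final 8 t' <> j) -> x l j = x t j.
  elim: l => [|l IHl]; first by rewrite leqn0 => /eqP->.
  rewrite leq_eqVlt => /predU1P[->//|tl] ln no; rewrite step //.
  case: eqP => [jE|_]; first by case: (no l).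
  by apply: IHl => // [|t' h1 h2]; [exact: ltnW|apply: no => //; exact: ltnW].
split=> [v vn|v]; last first.
  rewrite -xL; suff h l : l <= n -> x l v <= 1 by apply: h.
  elim: l => [|l IHl] ln; first by rewrite x0.
  by rewrite step //; case: eqP => _; [case: (_ == _)|apply: IHl; apply: ltnW].
have [t [tn qt _]] := y_order Y vn.
have inj := y_queue_inj Y.
have last j : final 8 j = v -> j < n -> j = t by move=> jv jn; apply: inj => //; rewrite qt.
rewrite -!xL (keep n t.+1 v) //; last first.
  by move=> t' h1 h2 /last h; have := h h2; lia.
rewrite step // qt eqxx; congr (nat_of_bool (~~ (_ == _))).
symmetry; apply: keep => //; first exact: ltnW.
move=> t' h1 h2 qE.
have tn' : top v < n by rewrite -qE; apply: (y_queue Y).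
have before u a b : u < n -> b < n -> par u < n -> final 8 a = u -> a < n ->
  final 8 b = par u -> b < a.
  move=> un bn pn qa an qb; have [a' [an' qa' [E|[b' ba qb']]]] := y_order Y un.
    by rewrite E ltnn in pn.
  have aE : a' = a by apply: inj => //; rewrite qa.
  have bE : b' = b by apply: inj => //; [lia|rewrite qb].
  by rewrite -aE -bE.
move: qE tn'; rewrite (top_loop vn); case: ifP => [mv|_] qE tn'; last first.
  by have := before v t t' vn h2 tn' qt tn qE; lia.
have pn : par v < n.
  move/mult_loop: mv => [j [jM dj lv _]]; have ev := y_slot Y jM; rewrite dj in ev.
  have rv := root_not_below Y (l_lt LS) ev lv.
  by have [] := par_lt Y (l_lt LS) vn rv.
have [t1 [t1n q1 _]] := y_order Y pn.
have b1 := before v t t1 vn t1n pn qt tn q1.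
have b2 := before (par v) t1 t' pn h2 tn' q1 t1n qE.
lia.
Qed.

Lemma flag_b1 : final 20 0 = 0 <-> forall v, v < n -> top (r2 v) = top v.
Proof.
loop 7 20 => -[x [x0 xS xL]]; rewrite -xL.
have -> := seq_flag x0 (c := fun t => top (r2 t) != top t); last by move=> t tM j;
  rewrite xS //; body.
by split=> h v vn; have := h v vn; [rewrite negbK => /eqP|move=> ->; rewrite eqxx].
Qed.

Lemma flag_b2 : final 26 0 = 0 <-> forall j, j < M -> mk (sm j) = mk (dm j).
Proof.
loop 13 26 => -[x [x0 xS xL]]; rewrite -xL.
have -> := seq_flag x0 (c := fun t => mk (sm t) != mk (dm t)); last by move=> t tM j;
  rewrite xS //; body.
by split=> h v vn; have := h v vn; [rewrite negbK => /eqP|move=> ->; rewrite eqxx].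
Qed.

Lemma flag_b3 : final 36 0 = 0 <-> forall j, j < M -> ~~ share final (src j) (dst j).
Proof.
loop 23 36 => -[x [x0 xS xL]]; rewrite -xL.
by apply: (seq_flag x0) => t tM j; rewrite xS //; body.
Qed.

Lemma s1_loop k : final 37 k = count (fun m =>
  (mk m == k) && lab1 final (mv m)) (iota 0 (n + n)).
Proof.
loop 24 37 => -[x [x0 xS xL]];
  rewrite -xL (seq_count x0 (c := fun t => lab1 final (mv t)) (f := mk)).
  by apply: eq_count => m /=; rewrite andbC.
by move=> t tM j; rewrite xS //; body; case: ifP => // /andP[_ /eqP->].
Qed.

Lemma s2_loop k : final 38 k = count (fun m =>
  (mk m == k) && lab2 final (mv m)) (iota 0 (n + n)).
Proof.
loop 25 38 => -[x [x0 xS xL]];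
  rewrite -xL (seq_count x0 (c := fun t => lab2 final (mv t)) (f := mk)).
  by apply: eq_count => m /=; rewrite andbC.
by move=> t tM j; rewrite xS //; body; case: ifP => // /andP[_ /eqP->].
Qed.

Lemma s12_loop k :
  final 39 k = count (fun m =>
    (mk m == k) && (lab1 final (mv m) || lab2 final (mv m))) (iota 0 (n + n)).
Proof.
loop 26 39 => -[x [x0 xS xL]];
  rewrite -xL (seq_count x0 (c := fun t =>
    lab1 final (mv t) || lab2 final (mv t)) (f := mk)).
  by apply: eq_count => m /=; rewrite andbC.
by move=> t tM j; rewrite xS //; body; case: ifP => // /andP[_ /eqP->].
Qed.

Lemma flag_b4 :
  final 40 0 = 0 <-> forall m, m < n + n -> final 27 m + sharing final m = final 28 (mk m).
Proof.
loop 27 40 => -[x [x0 xS xL]]; rewrite -xL.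
have -> := seq_flag x0 (c := fun t => final 27 t + sharing final t != final 28 (mk t)).
  by split=> h v vn; have := h v vn; [rewrite negbK => /eqP|move=> ->; rewrite eqxx].
move=> t tM j; rewrite xS // /sharing; body;
  rewrite -/(lab1 final (mv t)) -/(lab2 final (mv t)).
by case: (lab1 _ _); case: (lab2 _ _); case: (_ == final 28 _).
Qed.

Lemma final_results : results n M e final.
Proof.
split.
- exact: final_layering.
- exact: mult_loop.
- exact: top_loop.
- exact: r1_loop.
- exact: r2_loop.
- by move=> v vn; rewrite mk_loop ?vn //; lia.
- by move=> v vn; rewrite mk_loop; [rewrite ltnNge leq_addr /= addKn|lia].
- by move=> v vn; rewrite mv_loop ?vn //; lia.
- by move=> v vn; rewrite mv_loop; [rewrite ltnNge leq_addr /= addKn|lia].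
- exact: sm_loop.
- exact: dm_loop.
- exact: deg_loop.
- exact: sz_loop.
- exact: sg_loop.
- exact: has_loop.
- exact: any_loop.
- exact: db_loop.
- exact: ref_loop.
- by move=> m; have [] := ar_loop m.
- by move=> m; have [] := ar_loop m.
- exact: col_loop.1.
- exact: col_loop.2.
- exact: s1_loop.
- exact: s2_loop.
- exact: s12_loop.
- exact: flag_b1.
- exact: flag_b2.
- exact: flag_b3.
- exact: flag_b4.
Qed.

End Results.

(** * Linear time recognition *)

Lemma foldl_addn k r : foldl addn k r = k + sumn r.
Proof. by elim: r k => [|m r IHr] k /=; rewrite ?addn0 // IHr addnA. Qed.

Lemma load_start l i : i <= size l -> load l 1 i = sumn (take i (shape l)).
Proof.
case: i => [|i] il; first by rewrite take0.
by rewrite /load /= nth_scanl ?size_map // foldl_addn.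
Qed.

Lemma load_start_succ l u : u < size l ->
  load l 1 u.+1 = load l 1 u + size (nth [::] l u).
Proof.
move=> ul; rewrite (load_start ul) (load_start (ltnW ul)) (take_nth 0) ?size_map //
  sumn_rcons.
by rewrite (nth_map [::]).
Qed.

Lemma load_list l u c : u < size l -> c < size (nth [::] l u) ->
  load l 2 (load l 1 u + c) = nth 0 (nth [::] l u) c.
Proof.
move=> ul cl; rewrite (load_start (ltnW ul)) /load -/(flatten_index (shape l) u c)
  nth_flatten.
by rewrite flatten_indexKl ?flatten_indexKr // (nth_map [::]).
Qed.

Lemma load_end l : load l 1 (size l) = size (flatten l).
Proof. by rewrite load_start // -(size_map size l) take_size size_flatten. Qed.

Lemma load_leq l a i B : size l <= B -> size (flatten l) <= B ->
  all (fun r => all (fun w => w <= B) r) l -> load l a i <= B.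
Proof.
move=> lB fB rB; case: a => [|[|[|a]]] //; first by rewrite /load; case: ifP.
  have [il|il] := leqP i (size l); last first.
    by rewrite /load nth_default // /= size_scanl size_map.
  rewrite load_start //; apply: leq_trans fB; rewrite size_flatten.
  by rewrite -{2}(cat_take_drop i (shape l)) sumn_cat leq_addr.
rewrite /load; have [il|il] := ltnP i (size (flatten l)); last by rewrite nth_default.
have : nth 0 (flatten l) i \in flatten l by rewrite mem_nth.
by case/flattenP => r rl; move/allP: (allP rB r rl); apply.
Qed.

(** * The edge relation on vertex numbers *)

Section Lists.
Variables (T : finType) (G : graph T) (vs : seq T) (ns : T -> seq T).
Hypothesis A : adjacency_lists G vs ns.

Let l := encode vs ns.
Let idx v := index v vs.
Definition list_edge (i j : nat) : bool := j \in nth [::] (encode vs ns) i.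

Let e := list_edge.

Lemma vs_mem v : (v \in vs) = (v \in verts G).
Proof. by rewrite (perm_mem A.1) mem_enum. Qed.

Lemma vs_uniq : uniq vs. Proof. by rewrite (perm_uniq A.1) enum_uniq. Qed.

Lemma vs_size : size vs = #|verts G|. Proof. by rewrite (perm_size A.1) cardE. Qed.

Lemma ns_mem v w : v \in verts G -> (w \in ns v) = adjacent G v w.
Proof. by move=> vV; rewrite (perm_mem (A.2 v vV)) mem_enum. Qed.

Lemma ns_uniq v : v \in verts G -> uniq (ns v).
Proof. by move=> vV; rewrite (perm_uniq (A.2 v vV)) enum_uniq. Qed.

Lemma encode_size : size l = #|verts G|. Proof. by rewrite size_map vs_size. Qed.

Lemma idx_lt v : v \in verts G -> idx v < #|verts G|.
Proof. by rewrite -vs_mem -vs_size index_mem. Qed.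

Lemma idx_inj : {in verts G &, injective idx}.
Proof. by move=> v w; rewrite -!vs_mem => vV wV; apply: (index_inj v). Qed.

Lemma row u : u < #|verts G| ->
  exists v, [/\ v \in verts G, idx v = u & nth [::] l u = map idx (ns v)].
Proof.
rewrite -vs_size => us; case E: vs (us) => [//|x0 vs'] _.
have vu : nth x0 vs u \in vs by rewrite mem_nth.
exists (nth x0 vs u); split; first by rewrite -vs_mem.
  by rewrite /idx index_uniq // vs_uniq.
by rewrite (nth_map x0).
Qed.

Lemma rowE v : v \in verts G -> nth [::] l (idx v) = map idx (ns v).
Proof.
by move=> vV; have [w [wV /idx_inj wv ->]] := row (idx_lt vV); rewrite wv.
Qed.

Lemma idx_adj : {in verts G &, forall u v, adjacent G u v = e (idx u) (idx v)}.
Proof.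
move=> u v uV vV; rewrite /e /list_edge -/l rowE // -ns_mem //.
apply/idP/mapP => [vu|[w wu /idx_inj->//]]; first by exists v.
by move: wu; rewrite ns_mem // => /adjacent_verts[].
Qed.

Lemma edgeP i j : e i j ->
  exists u w, [/\ u \in verts G, w \in verts G, idx u = i, idx w = j & adjacent G u w].
Proof.
rewrite /e /list_edge -/l => ij; have iN : i < #|verts G|.
  by rewrite -encode_size ltnNge; apply/negP => h; move: ij; rewrite nth_default.
have [v [vV vi lv]] := row iN; move: ij; rewrite lv => /mapP[w wv jE].
have vw : adjacent G v w by rewrite -ns_mem.
by have [_ wV _] := adjacent_verts vw; exists v, w.
Qed.

Lemma edge_lt i j : e i j -> i < #|verts G| /\ j < #|verts G|.
Proof. by move=> /edgeP[u [w [uV wV <- <- _]]]; rewrite !idx_lt. Qed.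

Lemma edge_sym : symmetric e.
Proof.
suff h i j : e i j -> e j i by move=> i j; apply/idP/idP; apply: h.
by move=> /edgeP[u [w [uV wV <- <-]]]; rewrite adjacent_sym idx_adj.
Qed.

Lemma edge_irr : irreflexive e.
Proof.
move=> i; apply/negP => /edgeP[u [w [uV wV ui wi]]].
have -> : u = w by apply: idx_inj; rewrite // ui.
by move/adjacent_verts => []; rewrite eqxx.
Qed.

Lemma load_lists : lists #|verts G| (load l 1) (load l 2) e.
Proof.
have rng u j : u < #|verts G| -> load l 1 u <= j < load l 1 u.+1 ->
    exists c, [/\ c < size (nth [::] l u), j = load l 1 u + c & load l 2 j = nth 0 (nth
      [::] l u) c].
  move=> un; rewrite load_start_succ ?encode_size // => /andP[uj ju].
  exists (j - load l 1 u); have cl : j - load l 1 u < size (nth [::] l u) by lia.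
  by rewrite subnKC //; split=> //; rewrite -load_list ?subnKC // encode_size.
split.
- by [].
- by move=> u un; rewrite load_start_succ ?encode_size // leq_addr.
- by move=> u j un /(rng u j un)[c [cl _ ->]]; rewrite /e /list_edge mem_nth.
- move=> u w uw; have [un _] := edge_lt uw.
  have cl : index w (nth [::] l u) < size (nth [::] l u) by rewrite index_mem.
  exists (load l 1 u + index w (nth [::] l u)).
    by rewrite load_start_succ ?encode_size // leq_addr ltn_add2l.
  by rewrite load_list ?encode_size // nth_index.
- exact: edge_lt.
- move=> u j j' un /(rng u j un)[c [cl jE ->]] /(rng u j' un)[c' [cl' j'E ->]] cc.
  rewrite jE j'E; congr (_ + _); apply/eqP; rewrite -(nth_uniq 0 cl cl') ?cc //.
  have [v [vV _ ->]] := row un; rewrite map_inj_in_uniq ?ns_uniq // => w w'.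
  rewrite !ns_mem // => /adjacent_verts[_ wV _] /adjacent_verts[_ wV' _].
  exact: idx_inj.
- exact: edge_sym.
- exact: edge_irr.
Qed.

(** Double counting of incident pairs: an entry in the list of [v] is an edge at [v], and an edge
    has two ends. *)
Lemma encode_flatten : size (flatten l) <= 2 * #|edges G|.
Proof.
rewrite size_flatten /shape -map_comp sumnE big_map.
under eq_bigr => v _ do rewrite /= size_map.
rewrite (perm_big _ A.1) /= big_enum /=.
have deg_leq v : v \in verts G ->
  size (ns v) <= \sum_(ed in edges G) (if v \in ed then 1 else 0).
  move=> vV; rewrite (perm_size (A.2 v vV)) -cardE.
  rewrite -(card_in_imset (f := fun w => [set v; w]) (D := adjacent G v)); last first.
    move=> w w' vw vw' E; have : w \in [set v; w'] by rewrite -E !inE eqxx orbT.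
    have [_ _ vw0] := adjacent_verts vw.
    by rewrite !inE eq_sym (negbTE vw0) => /eqP.
  rewrite -big_mkcondr sum1dep_card; apply/subset_leq_card/subsetP => ed /imsetP[w vw ->].
  by rewrite !inE eqxx andbT.
apply: (@leq_trans (\sum_(v in verts G) \sum_(ed in edges G) (if v \in ed then 1 else
  0))); first exact: leq_sum.
rewrite exchange_big /=.
apply: (@leq_trans (\sum_(ed in edges G) 2)); last by rewrite sum_nat_const mulnC.
apply: leq_sum => ed edG; have /andP[_ /eqP ed2] := forall_inP (graphP G) ed edG.
rewrite -big_mkcondr sum1dep_card -ed2; apply/subset_leq_card/subsetP => v.
by rewrite inE => /andP[].
Qed.

Lemma encode_entries B : #|verts G| <= B -> all (fun r => all (fun w => w <= B) r) l.
Proof.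
move=> nB; apply/allP => _ /mapP[v _ ->]; apply/allP => _ /mapP[w _ ->].
by apply: leq_trans (index_size _ _) _; rewrite vs_size.
Qed.

Variable s : store.
Hypothesis C : results #|verts G| (size (flatten l)) e s.

Lemma complete : two_probe_block_graph G ->
  [/\ s 20 0 = 0, s 26 0 = 0, s 36 0 = 0 & s 40 0 = 0].
Proof.
move=> [N1 [N2 [G' [[N1V ind1] [N2V ind2] bG' [VE EE] fillE]]]].
pose e' i j := [exists u in verts G, exists w in verts G, [&& idx u == i, idx w == j &
  adjacent G' u w]].
have e'P i j : reflect (exists u w, [/\ u \in verts G, w \in verts G, idx u = i, idx w
  = j & adjacent G' u w]) (e' i j).
  apply: (iffP exists_inP) => [[u uV /exists_inP[w wV /and3P[/eqP ui /eqP wj uw]]]|].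
    by exists u, w.
  by case=> u [w [uV wV ui wj uw]]; exists u => //; apply/exists_inP; exists w;
    rewrite // ui wj !eqxx.
(* If [x] is not the number of a vertex, such as the absent top [n], any two vertices count as
   connected. *)
pose conn x a b := exists v w, [/\ v \in verts G, w \in verts G, idx v = a, idx w = b &
  forall u, u \in verts G -> idx u = x -> connect (adjacent (del_vertex G' u)) v w].
pose lab (N : {set T}) : pred nat := fun i => [exists v in N, idx v == i].
have labE (N : {set T}) v : N \subset verts G -> v \in verts G -> lab N (idx v) -> v \in N.
  by move=> /subsetP NV vV /exists_inP[w wN /eqP/idx_inj<-] //; apply: NV.
have labI (N : {set T}) v : v \in N -> lab N (idx v) by move=> vN; apply/exists_inP;
  exists v.
have sub u w : e u w -> e' u w.
  move=> /edgeP[x [y [xV yV xu yw xy]]]; apply/e'P; exists x, y; split=> //.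
  exact: (subsetP EE).
have sym : symmetric e'.
  suff h i j : e' i j -> e' j i by move=> i j; apply/idP/idP; apply: h.
  by move=> /e'P[u [w [uV wV ui wj uw]]]; apply/e'P; exists w, u; rewrite adjacent_sym.
have crefl x a : a < #|verts G| -> a != x -> conn x a a.
  move=> /row[v [vV va _]] _; exists v, v; split=> // *; exact: connect0.
have csym x a b : conn x a b -> conn x b a.
  move=> [v [w [vV wV va wb vw]]]; exists w, v; split=> // u uV ux.
  by rewrite (sym_connect_sym (@adjacent_sym T _)); apply: vw.
have ctrans x a b c : conn x a b -> conn x b c -> conn x a c.
  move=> [v [w [vV wV va wb vw]]] [w' [z [wV' zV wb' zc wz]]]; exists v, z;
    split=> // u uV ux.
  apply: connect_trans (vw u uV ux) _; have -> : w = w' by apply: idx_inj; rewrite // wb.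
  exact: wz.
have cedge x a b : e' a b -> a != x -> b != x -> conn x a b.
  move=> /e'P[v [w [vV wV va wb vw]]] ax bx; exists v, w; split=> // u uV ux.
  apply: connect1; rewrite adjacent_del vw /=.
  by apply/andP; split; [apply: contraNneq ax|apply: contraNneq bx] => E;
    rewrite -ux E ?va ?wb.
have star x a b : e' x a -> e' x b -> a != b -> conn x a b -> e' a b.
  move=> /e'P[u [v [uV vV ux va uv]]] /e'P[u' [w [uV' wV ux' wb uw]]] ab [v' [w' [vV'
    wV' va' wb' vw]]].
  have uu : u' = u by apply: idx_inj; rewrite // ux.
  have vv : v' = v by apply: idx_inj; rewrite // va.
  have ww : w' = w by apply: idx_inj; rewrite // wb.
  subst u' v' w'; apply/e'P; exists v, w; split=> //.
  apply: (block_graph_neighbours bG' uv uw); last exact: vw.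
  by apply: contraNneq ab => vw'; rewrite -va -wb vw'.
have nonadj u w : e' u w -> ~~ e u w -> meet (lab N1) (lab N2) u w.
  move=> /e'P[x [y [xV yV <- <- xy]]]; rewrite -idx_adj // => nxy.
  have : [set x; y] \in edges G' :\: edges G by rewrite in_setD; apply/andP.
  by move=> /fillE[] [/labI hx /labI hy]; rewrite /meet hx hy ?orbT.
have adj u w : e u w -> ~~ meet (lab N1) (lab N2) u w.
  move=> /edgeP[x [y [xV yV <- <- xy]]]; rewrite /meet; apply/negP => /orP[] /andP[hx hy].
    by have := ind1 x y (labE _ _ N1V xV hx) (labE _ _ N1V yV hy); rewrite xy.
  by have := ind2 x y (labE _ _ N2V xV hx) (labE _ _ N2V yV hy); rewrite xy.
split.
- apply/(c_b1 C) => v vn.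
  exact: (top_r2 C edge_lt edge_sym edge_irr sub sym crefl csym ctrans cedge
    star nonadj adj).
- apply/(c_b2 C) => j jM.
  exact: (mk_slot C edge_lt edge_sym edge_irr sub sym crefl csym ctrans cedge
    star nonadj adj).
- apply/(c_b3 C) => j jM.
  exact: (share_slot C edge_lt edge_sym edge_irr sub sym crefl csym ctrans
    cedge star nonadj adj).
- apply/(c_b4 C) => m mn.
  exact: (count_ok C edge_lt edge_sym edge_irr sub sym crefl csym ctrans cedge
    star nonadj adj).
Qed.

Lemma checks_complete :
  [/\ s 20 0 = 0, s 26 0 = 0, s 36 0 = 0 & s 40 0 = 0] <-> two_probe_block_graph G.
Proof.
split=> [[/(c_b1 C) b1 /(c_b2 C) b2 /(c_b3 C) b3 /(c_b4 C) b4]|]; last exact: complete.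
exact: (sound C edge_lt edge_sym edge_irr b1 b2 b3 b4 idx_lt idx_inj idx_adj).
Qed.

End Lists.

(** * Time and word size *)

Lemma loops_bounds s n M B : s 0 0 = n -> s 1 n = M -> M + (n + n) <= B ->
  all (fun l => eval s l.1 <= B) loops.
Proof. by move=> sn sM MB; rewrite /= sn sM; do ?(apply/andP; split) => //; lia. Qed.

(** As the base is at least 2, its power with exponent [C] exceeds [C]; a linear bound on stored
    values thus becomes a power of the base. *)
Lemma ltn_mul_expn C K m : C < K -> C * m.+2 < m.+2 ^ K.
Proof.
move=> CK; apply: (@leq_trans (m.+2 ^ C.+1)); last by rewrite leq_exp2l.
by rewrite expnS mulnC ltn_pmul2l // ltn_expl.
Qed.

Theorem theorem7 :
  exists (p : cmd) (c : nat),
  forall (T : finType) (G : graph T) (vs : seq T) (ns : T -> seq T),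
    adjacency_lists G vs ns ->
    let N := #|verts G| + #|edges G| in
    exists (t : nat) (s : store),
      [/\ exec (N.+2 ^ c) p (load (encode vs ns)) t s,
          t <= c * N.+1 &
          accepting s <-> two_probe_block_graph G].
Proof.
(* Inputs and numbers of rounds are at most [2 * N], so stored values are at most [C * N.+2]. The
   constant [K] serves as time factor, by its first two summands, and as exponent, by exceeding
   [C]. *)
pose C := 2 + 2 * prog_growth loops + growth verdict.
pose K := 2 * prog_cost loops + scost verdict + C.+1.
exists (prog_code loops (code verdict)), K.
move=> T G vs ns A; set n := #|verts G|; set m := #|edges G|; move=> N.
set l := encode vs ns; set M := size (flatten l).
have MN : M <= 2 * m by apply: (encode_flatten A).
have lN : size l = n := encode_size A.
have s0n : load l 0 0 = n by rewrite -lN.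
have s0M : load l 1 n = M by rewrite -lN load_end.
have NE : N = n + m by [].
have bounded0 : bounded (2 * N) (load l).
  move=> a i; apply: load_leq; first by rewrite lN NE; lia.
    by apply: leq_trans MN _; rewrite NE; lia.
  by apply: (encode_entries A); rewrite -/n NE; lia.
have bounds : all (fun lp => eval (load l) lp.1 <= 2 * N) loops.
  by apply: (loops_bounds s0n s0M); rewrite NE; lia.
have large : 2 * N + prog_growth loops * (2 * N) + growth verdict < N.+2 ^ K.
  apply: leq_ltn_trans (ltn_mul_expn N (_ : C < K)); last by rewrite /K; lia.
  by rewrite /C; move: (prog_growth loops) (growth verdict) => g g'; nia.
have [t ct et] := exec_prog (p := verdict) loops_wf isT bounded0 bounds large.
exists t, (den verdict (prog_den loops (load l))); split; first exact: et.
  apply: leq_trans ct _; rewrite /K.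
  by move: (prog_cost loops) (scost verdict) => g g'; nia.
(* The final store gets an opaque name, which keeps simplification from unfolding the program. *)
have [s sE] : {s | s = prog_den loops (load l)} by exists (prog_den loops (load l)).
have R : results n M (list_edge vs ns) s.
  by apply: (final_results s0n s0M _ (load_lists A) sE) => -[|[|[|a]]].
rewrite -sE -(checks_complete A R) /accepting /= /update /=.
by split=> [h|[-> -> -> ->]]; [split; lia | rewrite subn0].
Qed.
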